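(* Let $n$ be a positive integer and let $P$ be a self-inversive complex polynomial of degree $n$. Then for all $\alpha,\gamma\in\mathbb{C}$ with $\Re(\alpha)\leq \frac{n}{2}$ and $\Re(\gamma)\leq \frac{n}{2}$, and every $0\leq p<\infty$, $$\left\|zP'(z)-\alpha P(z)\right\|_p \leq \left\|(n-\alpha)z+\alpha\right\|_p\, \frac{\left\|P(z)\right\|_p}{\left\|1+z\right\|_p}$$ and $$\left\|z^2P''(z)+(1-\alpha-\gamma)zP'(z)+\alpha\gamma P(z)\right\|_p\leq \left\|\big(n(n-\alpha-\gamma)+\alpha\gamma\big)z+\alpha\gamma\right\|_p\,\frac{\left\|P(z)\right\|_p}{\left\|1+z\right\|_p}.$$ The inequalities are best possible, and equality holds in both for $P(z)=az^n+\bar{a}$, $|a|\neq 0$.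
   Context: A complex polynomial $P$ of degree $n$ is called self-inversive if there is $u\in\mathbb{C}$ with $|u|=1$ such that $P(z)=u z^n\overline{P(1/\overline{z})}$. For a complex polynomial $f(z)$ and $0<p<\infty$, $\|f(z)\|_p:=\left(\frac{1}{2\pi}\int_0^{2\pi}|f(e^{i\theta})|^p\,d\theta\right)^{1/p}$. For $p=0$, $\|f(z)\|_0:=\exp\left(\frac{1}{2\pi}\int_0^{2\pi}\log|f(e^{i\theta})|\,d\theta\right)$ (the Mahler measure), which is read as $0$ when $f$ is the zero polynomial. *)

(* Defs.v *)
From HB Require Import structures.
From mathcomp Require Import all_boot all_order all_algebra.
From mathcomp Require Import all_classical all_reals all_analysis.
From mathcomp Require Import complex.

Set Implicit Arguments.
Unset Strict Implicit.
Unset Printing Implicit Defensive.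

Import Order.TTheory GRing.Theory Num.Theory.
Import numFieldNormedType.Exports.

Local Open Scope ring_scope.
Local Open Scope complex_scope.

(* The degree of P is (size P).-1.  The identity is required at z != 0 only:
   in Rocq 0^-1 = 0, so at z = 0 it would wrongly force P(0) = 0. *)
Definition self_inversive (R : realType) (P : {poly R[i]}) : Prop :=
  exists2 u : R[i], `|u| = 1 &
    forall z : R[i], z != 0 ->
      P.[z] = u * z ^+ (size P).-1 * (P.[(z^*)^-1])^*.

(* |f(e^{it})| as an element of R; the norm `|_| of R[i] takes values in R[i]. *)
Definition circle_abs (R : realType) (f : {poly R[i]}) (t : R) : R :=
  complex.Re `|f.[cos t +i* sin t]|.

Definition circle_mean (R : realType) (g : R -> R) : R :=
  (2 * pi)^-1 * \int[lebesgue_measure]_(t in `[0%R, 2 * pi]%classic) g t.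

(* At exponent 0 a nonzero f has finitely many zeros on the circle, so the
   convention ln 0 = 0 only alters the integrand on a null set; for f = 0 it
   would give the value 1, hence the separate case. *)
Definition circle_norm (R : realType) (p : R) (f : {poly R[i]}) : R :=
  if p == 0 then
    if f == 0 then 0 else expR (circle_mean (fun t => ln (circle_abs f t)))
  else (circle_mean (fun t => circle_abs f t `^ p)) `^ p^-1.

(* Main.v *)
Require Import Defs.
From HB Require Import structures.
From mathcomp Require Import all_boot all_order all_algebra.
From mathcomp Require Import all_classical all_reals all_analysis.
From mathcomp Require Import measurable_realfun complex ring lra.
Set Implicit Arguments.
Unset Strict Implicit.
Unset Printing Implicit Defensive.
Import Order.TTheory GRing.Theory Num.Theory.
Import numFieldNormedType.Exports.
Local Open Scope ring_scope.
Local Open Scope complex_scope.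
Local Open Scope classical_set_scope.

(** For a polynomial q, let q(zD), where D = d/dz, be the operator that multiplies
    the coefficient of z^k by q(k) ([euler_op]).  The two operators of the theorem are
    q(zD) for q = X - alpha and for q = (X - alpha)(X - gamma), and the constants
    in front are the norms of q(n) z + q(0).  Everything rests on a first-order
    inequality that holds for all polynomials: if Re d <= n/2 and P has degree at
    most n, then
        ||zP' - dP||_p <= |n - d| ||P||_p   for 0 <= p.
    ([circle_norm0_euler] for p = 0, [euler_powR_integral_le] for p > 0.)

    Proof of the first-order inequality.  If all roots of G lie in the closed
    disk and |z| > 1, then Re (zG'(z)/G(z)) > n/2 >= Re d, so T = zD - d maps
    polynomials of degree n with all roots in the disk to such polynomials
    ([roots_in_disk_euler]).  Given F, reflect its roots lying outside the disk:
    this yields G of degree n with roots in the disk, |G| = |F| on the circle and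
    |G| >= |F| outside.  For |l| > 1 the polynomial F + lG has its roots in the
    disk, hence so has TF + l TG, which means |TF| <= |TG| outside the disk and
    on the circle ([euler_op_dominated], [euler_op_majorant]).  By Jensen's
    formula ([jensen]) the Mahler measure of a polynomial with roots in the disk
    is the modulus of its leading coefficient, so
        M(TF) <= M(TG) = |n - d| M(G) = |n - d| M(F),
    which is the case p = 0.  For p > 0 apply this to F = P + s e^(iy) z^n, for
    which TF = TP + (n - d) s e^(iy) z^n, and average over y.  By Jensen's formula
    again, the mean of log|w + s e^(iy)| is log max(|w|, s), so that the functions
    u = |TP|/|n - d| and v = |P| on the circle satisfy
        int log max(u, s) <= int log max(v, s)   for all s > 0
    ([mean_ln_max_euler]).  As u^p is a superposition with positive weights of the
    functions log max(u, s) - log s ([integral_ln_layer]), it follows that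
    int u^p <= int v^p ([powR_mean_le]).

    Self-inversive polynomials.  Let q be a product of factors X - a with
    Re a <= n/2, and let r be the product of the factors (n - conj a) - X.  If P
    is self-inversive of degree n, then |r(zD)P| = |q(zD)P| on the circle
    ([euler_conj_symbol]).  For |w| = 1 the polynomial q + w r vanishes
    identically or has all its roots in Re <= n/2 ([pencil_root]); it is then a
    product of linear factors, and iterating the first-order inequality gives
        ||(q + w r)(zD)P||_p <= |q(n) + w r(n)| ||P||_p.
    Raise this to the power p and integrate over the circle of all w.  At a point
    of the unit circle, A = q(zD)P and B = r(zD)P have the same modulus, so the
    mean of |A + wB|^p over w is |A|^p ||1 + z||_p^p; on the right, |r(n)| = |q(0)|
    and the mean of |q(n) + w r(n)|^p is ||q(n) z + q(0)||_p^p.  This is the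
    theorem for p > 0 ([self_inversive_powR_integral]).  For p = 0 the first-order
    inequality suffices, because ||1 + z||_0 = 1 and ||q(n) z + q(0)||_0 = |q(n)|.

    Equality.  q(zD) maps a z^n + conj a to q(n) a z^n + q(0) conj a.  The norm of
    a binomial b z^n + c depends only on |b| and |c|, and not on n >= 1
    ([circle_norm_binomial]); the case a = 1 shows that the constants are best
    possible. *)

(** * The operators q(zD) *)

Section EulerOperator.
Variable C : comNzRingType.
Implicit Types (P q r : {poly C}) (n k : nat).

(** The operator q(zD), given by its action on coefficients: sums and products of
    the symbol q become sums and composites of operators, which is what allows
    the symbol to be factored. *)
Definition euler_op q P : {poly C} := \poly_(k < size P) (q.[k%:R] * P`_k).

Lemma coef_euler_op q P k : (euler_op q P)`_k = q.[k%:R] * P`_k.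
Proof.
rewrite coef_poly; case: ltnP => // le_k.
by rewrite nth_default ?mulr0.
Qed.

Lemma euler_op0 q : euler_op q 0 = 0.
Proof. by apply/polyP => k; rewrite coef_euler_op !coef0 mulr0. Qed.

Lemma euler_opM q r P : euler_op (q * r) P = euler_op q (euler_op r P).
Proof. by apply/polyP => k; rewrite !coef_euler_op hornerM mulrA. Qed.

Lemma euler_opDl q r P : euler_op (q + r) P = euler_op q P + euler_op r P.
Proof. by apply/polyP => k; rewrite coefD !coef_euler_op hornerD mulrDl. Qed.

Lemma euler_opZl c q P : euler_op (c *: q) P = c *: euler_op q P.
Proof. by apply/polyP => k; rewrite coefZ !coef_euler_op hornerZ mulrA. Qed.

Lemma euler_opDr q P1 P2 : euler_op q (P1 + P2) = euler_op q P1 + euler_op q P2.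
Proof. by apply/polyP => k; rewrite !(coefD, coef_euler_op) mulrDr. Qed.

Lemma euler_opZr c q P : euler_op q (c *: P) = c *: euler_op q P.
Proof. by apply/polyP => k; rewrite !(coefZ, coef_euler_op) mulrCA. Qed.

Lemma euler_opC c P : euler_op c%:P P = c *: P.
Proof. by apply/polyP => k; rewrite coefZ coef_euler_op hornerC. Qed.

Lemma euler_opXn q n : euler_op q 'X^n = q.[n%:R] *: 'X^n.
Proof.
apply/polyP => k; rewrite coefZ coef_euler_op coefXn.
by case: eqP => [->|]; rewrite ?mulr0.
Qed.

Lemma euler_op_const q c : euler_op q c%:P = (q.[0] * c)%:P.
Proof.
apply/polyP => k; rewrite coef_euler_op !coefC.
by case: eqP => [->|]; rewrite ?mulr0.
Qed.

Lemma euler_opX P : euler_op 'X P = 'X * P^`().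
Proof.
apply/polyP => k; rewrite coef_euler_op hornerX coefXM.
by case: k => [|k] /=; rewrite ?mul0r // coef_deriv mulr_natl.
Qed.

Lemma euler_opXsubC a P : euler_op ('X - a%:P) P = 'X * P^`() - a *: P.
Proof. by rewrite -polyCN euler_opDl euler_opX euler_opC scaleNr. Qed.

Lemma euler_op_quad a b P :
  euler_op (('X - a%:P) * ('X - b%:P)) P =
  'X^2 * P^`(2) + (1 - a - b) *: ('X * P^`()) + (a * b) *: P.
Proof.
rewrite euler_opM !euler_opXsubC derivB derivM derivX derivZ mul1r.
rewrite derivnS derivn1 -!mul_polyC !polyCB !polyCM polyC1.
by rewrite expr2; ring.
Qed.

Lemma size_euler_op q P n : (size P <= n)%N -> (size (euler_op q P) <= n)%N.
Proof. exact/leq_trans/size_poly. Qed.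

End EulerOperator.

(** * Polynomials with all roots in the closed unit disk *)

Section Roots.
Variable R : realType.
Local Notation C := R[i].
Implicit Types (z w a d : C) (P F G : {poly C}) (n : nat) (s : seq C).
Local Notation Re := (@complex.Re R).
Local Notation Im := (@complex.Im R).

Lemma ltc_norm z w :
  (`|z| < `|w|) = (Re z ^+ 2 + Im z ^+ 2 < Re w ^+ 2 + Im w ^+ 2).
Proof. by rewrite -ltr_sqr ?nnegrE // -!add_Re2_Im2 ltcR. Qed.

Lemma lec_norm z w :
  (`|z| <= `|w|) = (Re z ^+ 2 + Im z ^+ 2 <= Re w ^+ 2 + Im w ^+ 2).
Proof. by rewrite -ler_sqr ?nnegrE // -!add_Re2_Im2 lecR. Qed.

Lemma half_lt_Re w : (1 / 2 < Re w) = (`|w - 1| < `|w|).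
Proof.
rewrite ltc_norm; case: w => x y /=.
by apply/idP/idP => h; lra.
Qed.

(** A root a contributes z / (z - a) to zG'(z)/G(z).  Now Re w > 1/2 means that w
    is closer to 0 than to 1 is, i.e. |w - 1| < |w|, and here w - 1 = a / (z - a). *)
Lemma half_lt_Re_div z a : `|a| < `|z| -> 1 / 2 < Re (z / (z - a)).
Proof.
move=> az; have za0 : z - a != 0.
  by rewrite subr_eq0; apply: contraTneq az => ->; rewrite ltxx.
rewrite half_lt_Re.
have -> : z / (z - a) - 1 = a / (z - a) by field.
by rewrite !normrM ltr_pM2r // normr_gt0 invr_eq0.
Qed.

(** The points a and n - conj a are symmetric about the line Re = n/2. *)
Lemma dist_reflectE n z a :
  (Re (z - a) ^+ 2 + Im (z - a) ^+ 2) =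
  (Re (z - (n%:R - a^*%C)) ^+ 2 + Im (z - (n%:R - a^*%C)) ^+ 2)
    + 4 * (Re z - n%:R / 2) * (n%:R / 2 - Re a).
Proof. by rewrite -(rmorph_nat (real_complex R)); case: z a => x y [u v] /=; field. Qed.

Lemma lt_dist_reflect n z a : n%:R / 2 < Re z -> Re a < n%:R / 2 ->
  `|z - (n%:R - a^*%C)| < `|z - a|.
Proof.
move=> nz an; rewrite ltc_norm (dist_reflectE n z a) ltrDl.
by rewrite !mulr_gt0 // subr_gt0.
Qed.

Lemma le_dist_reflect n z a : n%:R / 2 < Re z -> Re a <= n%:R / 2 ->
  `|z - (n%:R - a^*%C)| <= `|z - a|.
Proof.
move=> nz an; rewrite lec_norm (dist_reflectE n z a) lerDl.
by rewrite !mulr_ge0 ?subr_ge0 // ltW.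
Qed.

(** The logarithmic derivative of a product, with denominators cleared. *)
Lemma horner_log_deriv s z : all (fun a => z != a) s ->
  z * (\prod_(a <- s) ('X - a%:P))^`().[z] =
  (\prod_(a <- s) ('X - a%:P)).[z] * \sum_(a <- s) z / (z - a).
Proof.
elim: s => [_|a s IHs /= /andP[za /IHs{}IHs]].
  by rewrite !big_nil derivC hornerC !mulr0.
rewrite !big_cons derivM derivXsubC mul1r hornerD !hornerM hornerXsubC.
rewrite mulrDr mulrCA IHs; field.
by rewrite subr_eq0.
Qed.

Definition roots_in_disk n G :=
  size G = n.+1 /\ forall z, 1 < `|z| -> G.[z] != 0.

Lemma roots_in_disk_prod n G : roots_in_disk n G ->
  exists s, [/\ size s = n, all (fun a => `|a| <= 1) s
    & G = lead_coef G *: \prod_(a <- s) ('X - a%:P)].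
Proof.
move=> [sG nG]; have [s Gs] := closed_field_poly_normal G.
have G0 : lead_coef G != 0 by rewrite lead_coef_eq0 -size_poly_gt0 sG.
exists s; split=> //.
  by apply/eqP; rewrite -eqSS -sG Gs size_scale // size_prod_XsubC.
apply/allP => a sa; rewrite real_leNgt ?realE ?normr_ge0 ?ler01 //.
apply/negP => /nG; rewrite Gs hornerZ mulf_eq0 negb_or => /andP[_].
by rewrite -[_ == 0]/(root _ _) root_prod_XsubC sa.
Qed.

Lemma prod_roots_in_disk c s : c != 0 -> all (fun a => `|a| <= 1) s ->
  roots_in_disk (size s) (c *: \prod_(a <- s) ('X - a%:P)).
Proof.
move=> c0 /allP s1; split; first by rewrite size_scale // size_prod_XsubC.
move=> z z1; rewrite hornerZ mulf_eq0 negb_or c0 /=.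
rewrite -[_ == 0]/(root _ _) root_prod_XsubC.
by apply/negP => /s1 /(lt_le_trans z1); rewrite ltxx.
Qed.

Lemma root_shift_neq0 n d k : Re d <= n%:R / 2 -> n%:R / 2 < k -> k%:C - d != 0.
Proof.
move=> dn nk; rewrite subr_eq0; apply: contraTneq dn => <- /=.
by rewrite -ltNge.
Qed.

Lemma lt_half_nat n : (0 < n)%N -> n%:R / 2 < n%:R :> R.
Proof. by move=> n0; rewrite ltr_pdivrMr // ltr_pMr ?ltr0n // ltr1n. Qed.

Lemma natr_sub_neq0 n d : (0 < n)%N -> Re d <= n%:R / 2 -> n%:R - d != 0.
Proof.
move=> n0 dn; have := root_shift_neq0 dn (lt_half_nat n0).
by rewrite rmorph_nat.
Qed.

(** zG'(z)/G(z) is a sum of n terms with real part greater than 1/2, so it cannot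
    equal d when Re d <= n/2.  The degree is preserved because n - d is nonzero,
    which needs n > 0. *)
Lemma roots_in_disk_euler n d G : (0 < n)%N -> Re d <= n%:R / 2 ->
  roots_in_disk n G -> roots_in_disk n (euler_op ('X - d%:P) G).
Proof.
move=> n0 dn Gn; have [sG nG] := Gn; split.
  have G0 : lead_coef G != 0 by rewrite lead_coef_eq0 -size_poly_gt0 sG.
  apply/eqP; rewrite eqn_leq size_euler_op ?sG //= ltnNge.
  apply: contra G0 => /leq_sizeP /(_ n (leqnn _)) /eqP.
  rewrite coef_euler_op hornerXsubC mulf_eq0 (negPf (natr_sub_neq0 _ _)) //=.
  by rewrite lead_coefE sG.
move=> z z1; have := nG z z1; rewrite euler_opXsubC !hornerE.
have [s [sn s1 ->]] := roots_in_disk_prod Gn.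
set Q := \prod_(a <- s) _; set c := lead_coef G.
have zs : all (fun a => z != a) s.
  apply/allP => a /(allP s1) a1; apply: contraTneq z1 => ->.
  by rewrite real_ltNge ?realE ?normr_ge0 ?ler01 // a1.
rewrite derivZ !hornerZ => cQ0; rewrite mulrCA horner_log_deriv // -/Q.
set S := \sum_(a <- s) _.
have -> : c * (Q.[z] * S) - d * (c * Q.[z]) = (c * Q.[z]) * (S - d) by ring.
rewrite mulf_neq0 // subr_eq0.
suff: n%:R / 2 < Re S by apply: contraTneq => ->; rewrite -leNgt.
have {}s1 : all (fun a => `|a| < `|z|) s.
  by apply/allP => a /(allP s1) /le_lt_trans; apply.
have s0 : (0 < size s)%N by rewrite sn.
rewrite -sn /S; case: s s0 s1 {sn Q cQ0 zs S} => // a s _.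
elim: s a => [|b s IHs] a /= /andP[az bs].
  by rewrite big_seq1 half_lt_Re_div.
rewrite big_cons raddfD /= (le_lt_trans _ (ltrD (half_lt_Re_div az) (IHs b bs))) //.
by rewrite -mulrDl -[1]/(1%:R) -natrD add1n.
Qed.

End Roots.

(** * Reflection of roots and domination *)

Section Flip.
Variable R : realType.
Local Notation C := R[i].
Implicit Types (z w a d : C) (P F G : {poly C}) (n : nat) (s : seq C).
Local Notation Re := (@complex.Re R).
Local Notation Im := (@complex.Im R).

Lemma sqr_norm_reflect z a :
  `|a^*%C * z - 1| ^+ 2 = `|z - a| ^+ 2 + (`|a| ^+ 2 - 1) * (`|z| ^+ 2 - 1).
Proof.
rewrite -!add_Re2_Im2; case: z a => x y [u v].
by apply/eqP; rewrite eq_complex /=; apply/andP; split; apply/eqP; ring.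
Qed.

(** Outside the disk a root a with |a| > 1 is traded for 1 / conj a, with the
    factor conj a restoring the modulus on the circle. *)
Lemma flip_root a : exists k b, [/\ 1 <= `|k|, `|b| <= 1,
  forall z, 1 <= `|z| -> `|z - a| <= `|k * (z - b)|
  & forall z, `|z| = 1 -> `|z - a| = `|k * (z - b)|].
Proof.
have [a1|a1] := real_leP (normr_real a) (@real1 C).
  by exists 1, a; split=> // [|z _|z _]; rewrite ?mul1r // normr1.
have a0 : a^*%C != 0 by rewrite conjc_eq0 -normr_gt0 (lt_trans _ a1).
exists a^*%C, (a^*%C)^-1; rewrite normcJ ltW // normfV normcJ.
split=> // [|z z1|z z1]; first by rewrite invf_le1 ?ltW // (lt_trans _ a1).
  rewrite mulrBr divff // -ler_sqr ?nnegrE // sqr_norm_reflect lerDl.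
  by rewrite mulr_ge0 // subr_ge0 expr_ge1 // ltW.
rewrite mulrBr divff //; apply/eqP; rewrite -(@eqrXn2 _ 2) //.
by rewrite sqr_norm_reflect z1 expr1n subrr mulr0 addr0.
Qed.

(** When F has degree less than n, its roots at infinity are reflected to 0. *)
Lemma flip_roots n F : F != 0 -> (size F <= n.+1)%N ->
  exists G, [/\ roots_in_disk n G, `|F`_n| <= `|G`_n|,
    forall z, 1 < `|z| -> `|F.[z]| <= `|G.[z]|
    & forall z, `|z| = 1 -> `|F.[z]| = `|G.[z]|].
Proof.
move=> F0 sF; have [s Fs] := closed_field_poly_normal F.
have c0 : lead_coef F != 0 by rewrite lead_coef_eq0.
have sFs : size F = (size s).+1 by rewrite Fs size_scale // size_prod_XsubC.
have sn : (size s <= n)%N by rewrite -ltnS -sFs.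
have [k [t [st k1 t1 geF eqF]]] : exists k t, [/\ size t = n, 1 <= `|k|,
    all (fun b => `|b| <= 1) t,
    forall z, 1 <= `|z| -> `|\prod_(a <- s) (z - a)| <= `|k * \prod_(b <- t) (z - b)|
    & forall z, `|z| = 1 -> `|\prod_(a <- s) (z - a)| = `|k * \prod_(b <- t) (z - b)|].
  (* m is the number of roots at infinity, reflected to 0 *)
  rewrite -(subnK sn); move: (n - size s)%N => m.
  elim: s {F F0 sF Fs c0 sFs sn} => [|a s [k [t [st k1 t1 geF eqF]]]] /=.
    exists 1, (nseq m 0); rewrite size_nseq addn0 normr1 lexx.
    have prodE z : \prod_(b <- nseq m 0) (z - b) = z ^+ m.
      by rewrite big_nseq subr0 -Monoid.iteropE.
    split=> // [|z z1|z z1]; first by rewrite all_nseq normr0 ler01 orbT.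
      by rewrite big_nil prodE mul1r normr1 normrX exprn_ege1.
    by rewrite big_nil prodE mul1r normr1 normrX z1 expr1n.
  have [l [b [l1 b1 gea eqa]]] := flip_root a.
  have prodE z : l * k * \prod_(j <- b :: t) (z - j) =
      l * (z - b) * (k * \prod_(j <- t) (z - j)).
    by rewrite big_cons; ring.
  exists (l * k), (b :: t); rewrite /= st addnS b1 t1.
  split=> // [|z z1|z z1]; first by rewrite normrM mulr_ege1.
    by rewrite big_cons prodE 2!normrM ler_pM ?gea ?geF.
  by rewrite big_cons prodE normrM eqa // eqF // -normrM.
have k0 : k != 0 by rewrite -normr_gt0 (lt_le_trans _ k1).
have hornE u z : (\prod_(b <- u) ('X - b%:P)).[z] = \prod_(b <- u) (z - b).
  by rewrite horner_prod; apply: eq_bigr => b _; rewrite hornerXsubC.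
exists ((lead_coef F * k) *: \prod_(b <- t) ('X - b%:P)).
have Gn := prod_roots_in_disk (mulf_neq0 c0 k0) t1; split=> //.
- by rewrite -{1}st.
- have -> : ((lead_coef F * k) *: \prod_(b <- t) ('X - b%:P))`_n = lead_coef F * k.
    rewrite coefZ -{1}st (_ : size t = (size (\prod_(b <- t) ('X - b%:P))).-1).
      by rewrite -lead_coefE (monicP (monic_prod_XsubC _ _ _)) mulr1.
    by rewrite size_prod_XsubC.
  rewrite normrM; have [ns|ns] := eqVneq n (size s).
    by rewrite ns lead_coefE sFs /= ler_peMr.
  rewrite nth_default ?normr0 ?mulr_ge0 // sFs ltn_neqAle eq_sym ns //.
- move=> z /ltW z1; rewrite {1}Fs !hornerZ !hornE -mulrA 2!normrM.
  by rewrite ler_wpM2l // geF.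
- move=> z z1; rewrite {1}Fs !hornerZ !hornE -mulrA 2!normrM.
  by rewrite eqF.
Qed.

(** If |TF(z)| > |TG(z)| for some z outside the disk, then l = - TF(z)/TG(z) has
    modulus greater than 1; domination of F by G makes F + lG a polynomial of
    degree n with all roots in the disk, although T(F + lG) vanishes at z.  The
    hypothesis on the coefficients of z^n excludes a drop in degree. *)
Lemma euler_op_dominated n d F G : (0 < n)%N -> Re d <= n%:R / 2 ->
  (size F <= n.+1)%N -> roots_in_disk n G -> `|F`_n| <= `|G`_n| ->
  (forall z, 1 < `|z| -> `|F.[z]| <= `|G.[z]|) ->
  forall z, 1 < `|z| ->
    `|(euler_op ('X - d%:P) F).[z]| <= `|(euler_op ('X - d%:P) G).[z]|.
Proof.
move=> n0 dn sF Gn FGn FG z z1; have [sG nG] := Gn.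
set T := euler_op ('X - d%:P).
have [_ /(_ z z1) TG0] := roots_in_disk_euler n0 dn Gn.
rewrite real_leNgt ?normr_real //; apply/negP => TFG.
pose l := - ((T F).[z] / (T G).[z]).
have l1 : 1 < `|l| by rewrite normrN normrM normfV ltr_pdivlMr ?mul1r ?normr_gt0.
have lG x y : y != 0 -> `|x| <= `|y| -> x + l * y != 0.
  move=> y0 xy; rewrite addr_eq0; apply: contraTneq xy => ->.
  by rewrite normrN normrM -real_ltNge ?normr_real // ltr_pMl ?normr_gt0.
have Hn : roots_in_disk n (F + l *: G).
  split; last by move=> w w1; rewrite hornerD hornerZ lG ?nG ?FG.
  have : (F + l *: G)`_n != 0.
    rewrite coefD coefZ lG //.
    by rewrite (_ : G`_n = lead_coef G) ?lead_coef_eq0 -?size_poly_gt0 ?lead_coefE ?sG.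
  move=> H0; apply/eqP; rewrite eqn_leq; apply/andP; split; last first.
    by rewrite ltnNge; apply: contra H0 => /leq_sizeP ->.
  rewrite (leq_trans (size_polyD _ _)) // geq_max sF.
  by rewrite (leq_trans (size_scale_leq _ _)) ?sG.
have [_ /(_ z z1)] := roots_in_disk_euler n0 dn Hn.
rewrite euler_opDr euler_opZr -/T hornerD hornerZ /l mulNr.
by rewrite divfK ?TG0 // subrr eqxx.
Qed.

End Flip.

(** * Moduli, the unit circle and continuity *)

Section Modulus.
Variable R : realType.
Local Notation C := R[i].
Implicit Types (z w : C) (s t : R).

(** The real-valued modulus; the norm of R[i] takes its values in R[i]. *)
Definition cabs z : R := complex.Re `|z|.
Definition expi t : C := cos t +i* sin t.

Lemma cabsE z : (cabs z)%:C = `|z|.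
Proof. by rewrite RRe_real ?normr_real. Qed.

Lemma cabs_sqrt z : cabs z = Num.sqrt (complex.Re z ^+ 2 + complex.Im z ^+ 2).
Proof. by rewrite /cabs normc_def. Qed.

Lemma le_cabs z w : (cabs z <= cabs w) = (`|z| <= `|w|).
Proof. by rewrite -!cabsE lecR. Qed.

Lemma eq_cabs z w : `|z| = `|w| -> cabs z = cabs w.
Proof. by rewrite /cabs => ->. Qed.

Lemma cabs_ge0 z : 0 <= cabs z.
Proof. by rewrite -lecR cabsE normr_ge0. Qed.

Lemma cabs_eq0 z : (cabs z == 0) = (z == 0).
Proof. by rewrite -(inj_eq (@complexI R)) cabsE normr_eq0. Qed.

Lemma cabs_gt0 z : (0 < cabs z) = (z != 0).
Proof. by rewrite lt0r cabs_eq0 cabs_ge0 andbT. Qed.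

Lemma cabsM z w : cabs (z * w) = cabs z * cabs w.
Proof. by apply: (@complexI R); rewrite rmorphM /= !cabsE normrM. Qed.

Lemma cabsV z : cabs z^-1 = (cabs z)^-1.
Proof. by apply: (@complexI R); rewrite fmorphV /= !cabsE normfV. Qed.

Lemma cabsD z w : cabs (z + w) <= cabs z + cabs w.
Proof. by rewrite -lecR rmorphD /= !cabsE ler_normD. Qed.

Lemma cabsN z : cabs (- z) = cabs z.
Proof. by rewrite /cabs normrN. Qed.

Lemma cabsJ z : cabs z^*%C = cabs z.
Proof. by apply: eq_cabs; rewrite normcJ. Qed.

Lemma cabs0 : cabs 0 = 0.
Proof. by rewrite /cabs normr0. Qed.

Lemma cabs1 : cabs 1 = 1.
Proof. by rewrite /cabs normr1. Qed.

Lemma cabsX z n : cabs (z ^+ n) = cabs z ^+ n.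
Proof. by elim: n => [|n IHn]; rewrite ?cabs1 // !exprS cabsM IHn. Qed.

Lemma cabs_real s : cabs s%:C = `|s|.
Proof. by rewrite cabs_sqrt /= expr0n addr0 sqrtr_sqr. Qed.

Lemma cabsB z w : cabs z - cabs w <= cabs (z - w).
Proof. by rewrite lerBlDr (le_trans _ (cabsD _ _)) // subrK. Qed.

Lemma cabs_expi t : cabs (expi t) = 1.
Proof. by rewrite cabs_sqrt /= cos2Dsin2 sqrtr1. Qed.

Lemma norm_expi t : `|expi t| = 1.
Proof. by rewrite -cabsE cabs_expi. Qed.

Lemma expi_neq0 t : expi t != 0.
Proof. by rewrite -cabs_gt0 cabs_expi. Qed.

Lemma expiD s t : expi (s + t) = expi s * expi t.
Proof. by rewrite /expi cosD sinD; apply/eqP; rewrite eq_complex /= !eqxx addrC eqxx. Qed.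

Lemma expi0 : expi 0 = 1.
Proof. by rewrite /expi cos0 sin0. Qed.

Lemma expiMn t n : expi (t *+ n) = expi t ^+ n.
Proof. by elim: n => [|n IHn]; rewrite ?expi0 // mulrS expiD IHn exprS. Qed.

Lemma expi_pi : expi pi = -1.
Proof. by rewrite /expi cospi sinpi; apply/eqP; rewrite eq_complex /= oppr0 !eqxx. Qed.

Lemma expi_2pi : expi (2 * pi) = 1.
Proof. by rewrite mulr_natl expiMn expi_pi expr2 mulrNN mulr1. Qed.

Lemma expi_surj z : `|z| = 1 -> exists2 t, 0 <= t <= 2 * pi & z = expi t.
Proof.
move=> z1; have {z1} : complex.Re z ^+ 2 + complex.Im z ^+ 2 = 1.
  by apply: (@complexI R); rewrite add_Re2_Im2 z1 expr1n.
case: z => x y /= xy1.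
have x1 : -1 <= x <= 1 by apply/andP; split; nra.
have y2 : Num.sqrt (1 - x ^+ 2) = `|y| by rewrite -xy1 addrAC subrr add0r sqrtr_sqr.
have c := acosK x1; have s := sin_acos x1.
have [y0|y0] := leP 0 y.
  exists (acos x); last by rewrite /expi c s y2 ger0_norm.
  by rewrite acos_ge0 // (le_trans (acos_lepi x1)) // mulr_natl mulr2n lerDl pi_ge0.
exists (2 * pi - acos x); last first.
  rewrite /expi cosB sinB mulr_natl cos2pi sin2pi c s y2 ltr0_norm //.
  by rewrite !mul0r !mul1r addr0 sub0r opprK.
rewrite subr_ge0 gerBl acos_ge0 // (le_trans (acos_lepi x1)) ?mulr_natl //.
by rewrite mulr2n lerDl pi_ge0.
Qed.

End Modulus.

Section ComplexContinuity.
Variable R : realType.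
Local Notation C := R[i].
Implicit Types (f g : R -> C) (P F G : {poly C}).

(** Continuity is expressed on real and imaginary parts, so that only the topology
    of R enters. *)
Definition ccontinuous f :=
  continuous (fun t => complex.Re (f t)) /\ continuous (fun t => complex.Im (f t)).

Lemma ccontinuous_cst z : ccontinuous (fun=> z).
Proof. by split=> x; exact: cvg_cst. Qed.

Lemma ccontinuousD f g : ccontinuous f -> ccontinuous g ->
  ccontinuous (fun t => f t + g t).
Proof.
move=> [cf cf'] [cg cg']; split=> x; under eq_fun do rewrite raddfD /=.
  by apply: (@continuousD _ R^o _ _ _ x); [exact: cf|exact: cg].
by apply: (@continuousD _ R^o _ _ _ x); [exact: cf'|exact: cg'].
Qed.

Lemma ccontinuousM f g : ccontinuous f -> ccontinuous g ->
  ccontinuous (fun t => f t * g t).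
Proof.
move=> [cf cf'] [cg cg'].
have ReM z w : complex.Re (z * w : C) =
  complex.Re z * complex.Re w - complex.Im z * complex.Im w by case: z; case: w.
have ImM z w : complex.Im (z * w : C) =
  complex.Re z * complex.Im w + complex.Im z * complex.Re w by case: z; case: w.
split=> x.
  under eq_fun do rewrite ReM.
  apply: (@continuousB _ R^o _ _ _ x); apply: continuousM;
  [exact: cf|exact: cg|exact: cf'|exact: cg'].
under eq_fun do rewrite ImM.
apply: (@continuousD _ R^o _ _ _ x); apply: continuousM;
[exact: cf|exact: cg'|exact: cf'|exact: cg].
Qed.

Lemma ccontinuous_horner P f : ccontinuous f -> ccontinuous (fun t => P.[f t]).
Proof.
move=> cf; elim/poly_ind: P => [|P c IHP].
  by under eq_fun do rewrite horner0; exact: ccontinuous_cst.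
under eq_fun do rewrite hornerMXaddC.
by apply: ccontinuousD (ccontinuous_cst _); exact: ccontinuousM.
Qed.

Lemma ccontinuous_expi : ccontinuous (@expi R).
Proof. by split; [exact: continuous_cos|exact: continuous_sin]. Qed.

Lemma continuous_cabs f : ccontinuous f -> continuous (fun t => cabs (f t)).
Proof.
move=> [cf cf'] x; under eq_fun do rewrite cabs_sqrt !expr2.
apply: (@continuous_comp _ _ _ (fun t => _) Num.sqrt); last exact: sqrt_continuous.
by apply: (@continuousD _ R^o _ _ _ x); apply: continuousM;
  [exact: cf|exact: cf|exact: cf'|exact: cf'].
Qed.

(** A point of the circle is the limit of r z as r decreases to 1. *)
Lemma horner_norm_le_closed F G :
  (forall z, 1 < `|z| -> `|F.[z]| <= `|G.[z]|) ->
  forall z, 1 <= `|z| -> `|F.[z]| <= `|G.[z]|.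
Proof.
move=> FG z z1; rewrite -le_cabs.
have cts : ccontinuous (fun r : R => r%:C * z).
  by apply: ccontinuousM (ccontinuous_cst _); split=> x;
     [exact: cvg_id | exact: cvg_cst].
have lim P : cabs P.[r%:C * z] @[r --> (1 : R)^'+] --> cabs P.[z].
  rewrite -{2}[z]mul1r -(rmorph1 (real_complex R)).
  apply: (cvg_at_right_filter (f := fun r : R => cabs P.[r%:C * z])).
  exact: continuous_cabs (ccontinuous_horner _ cts) _.
apply: (ler_cvg_to (lim F) (lim G)); near=> r.
rewrite le_cabs FG // normrM -cabsE cabs_real.
have r1 : 1 < r by [].
rewrite (lt_le_trans _ (ler_peMr _ z1)) //.
  by rewrite -(rmorph1 (real_complex R)) ltcR gtr0_norm // (lt_trans _ r1).
by rewrite lecR.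
Unshelve. all: by end_near. Qed.

End ComplexContinuity.

(** * Integrals of periodic continuous functions *)

Section PeriodicIntegral.
Variable R : realType.
Implicit Types (h : R -> R) (a b c s t : R).
Local Notation mu := (@lebesgue_measure R).

Lemma integrable_continuous_itv h a b :
  continuous h -> mu.-integrable `[a, b] (EFin \o h).
Proof.
move=> ch; apply: continuous_compact_integrable; first exact: segment_compact.
exact: continuous_subspaceT.
Qed.

Lemma Rintegral_itv_cat h a b c : continuous h -> a <= b -> b <= c ->
  \int[mu]_(t in `[a, c]) h t =
  \int[mu]_(t in `[a, b]) h t + \int[mu]_(t in `[b, c]) h t.
Proof.
move=> ch ab bc; rewrite -(Rintegral_itv_obnd_cbnd (r := b)); last first.
  apply: integrableS (integrable_continuous_itv b c ch) => //.
  by apply: subset_itv_oc_cc.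
rewrite -(@Rintegral_itvB _ _ (BLeft a) (BRight c) b) ?bnd_simp //.
  by rewrite addrC subrK.
exact: integrable_continuous_itv.
Qed.

(** Substitution, valid without periodicity; rotations and dilations of the circle
    are deduced from it by cutting intervals at multiples of the period. *)
Lemma Rintegral_affine h k c a b : continuous h -> 0 < k -> a <= b ->
  \int[mu]_(t in `[a, b]) (k * h (k * t + c)) =
  \int[mu]_(t in `[k * a + c, k * b + c]) h t.
Proof.
move=> ch k0 ab; rewrite /Rintegral; congr fine.
pose F t := k * t + c.
have dF : F^`() = cst k.
  apply/funext => x; rewrite derive1E /F deriveD // derive_cst addr0 deriveM //.
  by rewrite derive_cst derive_id scaler0 addr0 /GRing.scale /= mulr1.
have cF : continuous F.
  move=> x; apply: (@continuousD _ R^o _ _ _ x); last exact: cvg_cst.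
  by apply: continuousM; [exact: cvg_cst|exact: cvg_id].
rewrite [RHS](@integration_by_substitution_increasing _ F h a b) //.
- by apply: eq_integral => x _; rewrite dF /= mulrC.
- by move=> x y _ _ xy; rewrite ltrD2r ltr_pM2l.
- by rewrite dF => x _; exact: cvg_cst.
- by rewrite dF; exact: is_cvg_cst.
- by rewrite dF; exact: is_cvg_cst.
- split.
  + by move=> x _; rewrite /F; exact: derivableD.
  + exact: cvg_at_right_filter (cF a).
  + exact: cvg_at_left_filter (cF b).
- exact: continuous_subspaceT.
Qed.

Lemma Rintegral_shift h c a b : continuous h -> a <= b ->
  \int[mu]_(t in `[a, b]) h (t + c) = \int[mu]_(t in `[a + c, b + c]) h t.
Proof.
move=> ch ab; rewrite -[a in RHS]mul1r -[b in RHS]mul1r -Rintegral_affine //.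
by apply: eq_Rintegral => x _; rewrite !mul1r.
Qed.

Let L : R := 2 * pi.
Let L0 : 0 <= L. Proof. by rewrite mulr_ge0 ?pi_ge0. Qed.

Lemma Rintegral_rotate h s : continuous h -> (forall t, h (t + L) = h t) ->
  0 <= s <= L ->
  \int[mu]_(t in `[0, L]) h (t + s) = \int[mu]_(t in `[0, L]) h t.
Proof.
move=> ch hL /andP[s0 sL]; rewrite Rintegral_shift // add0r.
rewrite (@Rintegral_itv_cat _ s L) // ?lerDl // (@Rintegral_itv_cat h 0 s L) //.
rewrite addrC; congr (_ + _).
have := Rintegral_shift L ch s0; rewrite add0r [s + L]addrC => <-.
by apply: eq_Rintegral => x _.
Qed.

Lemma Rintegral_dilate h n : continuous h -> (forall t, h (t + L) = h t) ->
  (0 < n)%N ->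
  \int[mu]_(t in `[0, L]) h (n%:R * t) = \int[mu]_(t in `[0, L]) h t.
Proof.
move=> ch hL n0.
have nR : n%:R != 0 :> R by rewrite pnatr_eq0 -lt0n.
have ch' : continuous (fun t => h (n%:R * t)).
  move=> x; apply: (@continuous_comp _ _ _ (fun t => n%:R * t) h); last exact: ch.
  by apply: continuousM; [exact: cvg_cst|exact: cvg_id].
apply: (mulfI nR).
rewrite -RintegralZl //; last exact: integrable_continuous_itv.
under eq_Rintegral do rewrite -[X in h X]addr0.
rewrite Rintegral_affine // ?ltr0n // mulr0 !addr0.
elim: n {n0 nR ch'} => [|n IHn]; first by rewrite !mul0r set_itv1 Rintegral_set1.
rewrite (@Rintegral_itv_cat _ _ (n%:R * L)) //; last 2 first.
- by rewrite mulr_ge0.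
- by rewrite ler_wpM2r // ler_nat.
rewrite IHn -natr1 !mulrDl; congr (_ + _).
have := Rintegral_shift (n%:R * L) ch L0.
rewrite add0r [L + _]addrC !mul1r => <-.
apply: eq_Rintegral => x _; elim: n x {IHn} => [|n IHn] x; first by rewrite mul0r addr0.
by rewrite -addn1 natrD mulrDl mul1r addrA hL.
Qed.

End PeriodicIntegral.

(** * Jensen's formula *)

Section JensenInside.
Variable R : realType.
Local Notation C := R[i].
Local Notation mu := (@lebesgue_measure R).
Local Notation circle := (`[0, 2 * pi]%classic : set R).
Implicit Types (z w : C) (s t : R).

Lemma twopi_gt0 : 0 < 2 * pi :> R.
Proof. by rewrite mulr_gt0 ?pi_gt0. Qed.

Lemma lebesgue_circle : mu circle = (2 * pi)%:E.
Proof. by rewrite lebesgue_measure_itv /= lte_fin twopi_gt0 oppr0 adde0. Qed.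

Lemma le0_natmul_bounded (x B : R) : (forall k, x * k%:R <= B) -> x <= 0.
Proof.
move=> xB; rewrite leNgt; apply/negP => x0.
have := archi_boundP (_ : 0 <= `|B| / x).
rewrite divr_ge0 // ?ltW // => /(_ isT).
rewrite ltr_pdivrMr // mulrC => /(le_lt_trans (ler_norm B)).
by rewrite ltNge xB.
Qed.

Lemma continuous_ln_comp (h : R -> R) :
  continuous h -> (forall t, 0 < h t) -> continuous (fun t => ln (h t)).
Proof.
move=> ch h0 x; apply: (@continuous_comp _ _ _ h (@ln R)); first exact: ch.
by apply: continuous_ln; exact: h0.
Qed.

Lemma ccontinuous_expi_shift z : ccontinuous (fun t => expi t + z).
Proof. exact: ccontinuousD (@ccontinuous_expi R) (@ccontinuous_cst R z). Qed.

Section Inside.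

Let J z := \int[mu]_(t in circle) ln (cabs (expi t - z)).

Let gt0 z t : cabs z < 1 -> 0 < cabs (expi t - z).
Proof. by move=> z1; rewrite (lt_le_trans _ (cabsB _ _)) // cabs_expi subr_gt0. Qed.

Let cts z : cabs z < 1 -> continuous (fun t => ln (cabs (expi t - z))).
Proof.
move=> z1; apply: continuous_ln_comp => [|t]; last exact: gt0.
exact: continuous_cabs (ccontinuous_expi_shift _).
Qed.

Let expi_per t : expi (t + 2 * pi) = expi t :> C.
Proof. by rewrite expiD expi_2pi mulr1. Qed.

Let J_opp z : cabs z < 1 -> J (- z) = J z.
Proof.
move=> z1; rewrite /J -(@Rintegral_rotate _ _ pi).
- apply: eq_Rintegral => t _.
  by rewrite expiD expi_pi mulrN1 -opprD cabsN.
- by apply: cts; rewrite cabsN.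
- by move=> t; rewrite expi_per.
- by rewrite pi_ge0 mulr_natl mulr2n lerDl pi_ge0.
Qed.

Let cabs_sqr_lt1 z : cabs z < 1 -> cabs (z ^+ 2) < 1.
Proof. by move=> z1; rewrite cabsX exprn_ilt1 ?cabs_ge0. Qed.

Let J_sqr z : cabs z < 1 -> J (z ^+ 2) = 2 * J z.
Proof.
move=> z1; rewrite mulr_natl mulr2n -{1}(J_opp z1) /J -RintegralD //; last 2 first.
- by apply: integrable_continuous_itv; apply: cts; rewrite cabsN.
- by apply: integrable_continuous_itv; exact: cts.
rewrite -(@Rintegral_dilate _ _ 2) //.
- apply: eq_Rintegral => t _; rewrite -lnM ?posrE ?gt0 ?cabsN //.
  by rewrite -cabsM opprK [in RHS]mulrC -subr_sqr mulr_natl expiMn.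
- by apply: cts; exact: cabs_sqr_lt1.
- by move=> t; rewrite expi_per.
Qed.

Let J_bound r z : r < 1 -> cabs z <= r -> `|J z| <= - ln (1 - r) * (2 * pi).
Proof.
move=> r1 zr; have z1 : cabs z < 1 by exact: le_lt_trans zr r1.
have r0 : 0 < 1 - r by rewrite subr_gt0.
have i := integrable_continuous_itv 0 (2 * pi) (cts z1).
apply: (le_trans (le_normr_Rintegral _ i)) => //.
have -> : - ln (1 - r) * (2 * pi) = \int[mu]_(_ in circle) (- ln (1 - r)).
  rewrite Rintegral_cst //; congr (_ * _).
  exact/esym/(congr1 fine lebesgue_circle).
apply: le_Rintegral => //.
- by apply: integrable_norm.
- by apply: integrable_continuous_itv => x; exact: cvg_cst.
(* 1 - r <= |e^(it) - z| <= 1 + r <= 1 / (1 - r) *)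
move=> t _; rewrite ler_norml opprK -lnV ?posrE // !ler_ln ?posrE ?gt0 ?invr_gt0 //.
rewrite (le_trans _ (cabsB _ _)) /=; last by rewrite cabs_expi lerB.
rewrite (le_trans (cabsD _ _)) // cabs_expi cabsN.
rewrite -[leRHS]mul1r ler_pdivlMr //; have := cabs_ge0 z; nra.
Qed.

(** Doubling: since e^(2it) - z^2 = (e^(it) - z)(e^(it) + z), the mean J(z) of
    log|e^(it) - z| satisfies J(z^2) = 2 J(z), hence J(z^(2^k)) = 2^k J(z).  But J
    is bounded on the disk of radius |z|, so J(z) = 0. *)
Lemma jensen_inside z : cabs z < 1 -> \int[mu]_(t in circle) ln (cabs (expi t - z)) = 0.
Proof.
move=> z1; apply/eqP; rewrite -normr_le0.
apply: (@le0_natmul_bounded _ (- ln (1 - cabs z) * (2 * pi))) => k.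
have [w [wz Jw]] : exists w, cabs w <= cabs z /\ J w = 2 ^+ k * J z.
  elim: k => [|k [w [wz Jw]]]; first by exists z; rewrite mul1r.
  have w1 := le_lt_trans wz z1.
  exists (w ^+ 2); rewrite J_sqr // Jw [2 ^+ k.+1]exprS mulrA; split=> //.
  by rewrite (le_trans _ wz) // cabsX expr2 ler_piMr ?cabs_ge0 ?ltW.
rewrite (le_trans _ (J_bound z1 wz)) // Jw normrM mulrC ler_wpM2r //.
by rewrite ger0_norm ?exprn_ge0 // -natrX ler_nat ltnW // ltn_expl.
Qed.

End Inside.
End JensenInside.

Section ExtendedLog.
Variable R : realType.
Implicit Types x y : R.

(** The logarithm with value -oo at 0: it makes log|fg| = log|f| + log|g| hold at
    the zeros as well, so that no exceptional null set has to be carried along. *)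
Definition elog x : \bar R := lne x%:E.

Lemma elog_gt0 x : 0 < x -> elog x = (ln x)%:E.
Proof. exact: lne_EFin. Qed.

Lemma elog0 : elog 0 = -oo%E.
Proof. by rewrite /elog le0_lneNy. Qed.

Lemma elog_lty x : (elog x < +oo)%E.
Proof. by rewrite /elog /=; case: ifP => _; rewrite ?ltry. Qed.

Lemma elogM x y : 0 <= x -> 0 <= y -> elog (x * y) = (elog x + elog y)%E.
Proof.
rewrite le0r => /predU1P[-> _|x0].
  rewrite mul0r elog0; have := elog_lty y.
  by case: (elog y).
rewrite le0r => /predU1P[->|y0].
  by rewrite mulr0 elog0 elog_gt0.
by rewrite !elog_gt0 ?mulr_gt0 // lnM.
Qed.

Lemma le_elog x y : x <= y -> (elog x <= elog y)%E.
Proof.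
move=> xy; have [x0|x0] := leP x 0.
  by rewrite {1}/elog le0_lneNy ?lee_fin // leNye.
rewrite !elog_gt0 ?(lt_le_trans x0) // lee_fin ler_ln //.
by rewrite posrE (lt_le_trans x0).
Qed.

Lemma elog_le_ln x y : 0 < y -> x <= y -> (elog x <= (ln y)%:E)%E.
Proof. by move=> y0 xy; rewrite -elog_gt0 // le_elog. Qed.

Lemma measurable_elog : measurable_fun [set: R] elog.
Proof.
rewrite /elog /=; apply: measurable_fun_ifT => //.
- exact: measurable_fun_ler.
- by apply/measurable_EFinP; exact: measurable_ln.
Qed.

End ExtendedLog.
#[global] Hint Extern 0 (measurable_fun _ (@elog _)) => exact: measurable_elog : core.

Section Jensen.
Variable R : realType.
Local Notation C := R[i].
Local Notation mu := (@lebesgue_measure R).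
Local Notation circle := (`[0, 2 * pi]%classic : set R).
Implicit Types (z w : C) (s t : R).

Lemma measurable_elog_cabs (f : R -> C) (D : set R) : ccontinuous f ->
  measurable_fun D (fun t => elog (cabs (f t))).
Proof.
move=> cf; apply: measurable_funTS; apply: measurableT_comp => //.
by apply: continuous_measurable_fun; exact: continuous_cabs.
Qed.

Lemma integral_circle_cst (c : R) : (\int[mu]_(t in circle) c%:E = (2 * pi * c)%:E)%E.
Proof.
rewrite integral_cst //; rewrite [X in (_ * X)%E](_ : _ = (2 * pi)%:E).
  by rewrite -EFinM mulrC.
exact: lebesgue_circle.
Qed.

Lemma integrable_circle_cst (c : R) : mu.-integrable circle (fun=> c%:E).
Proof.
apply: (@integrable_continuous_itv _ (fun=> c)) => x; exact: cvg_cst.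
Qed.

Lemma integrable_circle_shift (f : R -> \bar R) (c v : R) :
  mu.-integrable circle f -> (\int[mu]_(t in circle) f t = (2 * pi * v)%:E)%E ->
  mu.-integrable circle (fun t => c%:E + f t)%E /\
  (\int[mu]_(t in circle) (c%:E + f t) = (2 * pi * (c + v))%:E)%E.
Proof.
move=> fi fv; have ci := integrable_circle_cst c; split.
  by apply: integrableD.
by rewrite integralD // integral_circle_cst fv -EFinD -mulrDr.
Qed.

(** log|f| is integrable over the circle, with mean value v. *)
Definition log_mean (f : R -> C) (v : R) :=
  mu.-integrable circle (fun t => elog (cabs (f t))) /\
  (\int[mu]_(t in circle) elog (cabs (f t)) = (2 * pi * v)%:E)%E.

Lemma log_mean_inside z : cabs z < 1 -> log_mean (fun t => expi t - z) 0.
Proof.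
move=> z1.
have gt0 t : 0 < cabs (expi t - z).
  by rewrite (lt_le_trans _ (cabsB _ _)) // cabs_expi subr_gt0.
have cts : continuous (fun t => ln (cabs (expi t - z))).
  apply: continuous_ln_comp => // .
  exact: continuous_cabs (ccontinuous_expi_shift _).
rewrite /log_mean.
have -> : (fun t => elog (cabs (expi t - z))) = EFin \o (fun t => ln (cabs (expi t - z))).
  by apply/funext => t; rewrite elog_gt0.
have i := integrable_continuous_itv 0 (2 * pi) cts; split=> //.
rewrite mulr0 -[X in _ = X%:E](jensen_inside z1) /Rintegral fineK //.
exact: integrable_fin_num i.
Qed.

Lemma log_mean_scale f v (c : C) : c != 0 -> log_mean f v ->
  log_mean (fun t => c * f t) (ln (cabs c) + v).
Proof.
move=> c0 [fi fv]; have := integrable_circle_shift (ln (cabs c)) fi fv.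
suff -> : (fun t => (ln (cabs c))%:E + elog (cabs (f t)))%E =
  (fun t => elog (cabs (c * f t))) by [].
by apply/funext => t; rewrite cabsM elogM ?cabs_ge0 // (@elog_gt0 _ (cabs c)) ?cabs_gt0.
Qed.

Lemma eq_log_mean f g v : (forall t, cabs (f t) = cabs (g t)) ->
  log_mean f v -> log_mean g v.
Proof.
rewrite /log_mean => fg.
suff -> : (fun t => elog (cabs (f t))) = (fun t => elog (cabs (g t))) by [].
by apply/funext => t; rewrite fg.
Qed.

(** |e^(it) - z| = |z| |e^(it) - 1 / conj z|. *)
Lemma log_mean_outside z : 1 < cabs z ->
  log_mean (fun t => expi t - z) (ln (cabs z)).
Proof.
move=> z1; have z0 : z != 0 by rewrite -cabs_gt0 (lt_trans _ z1).
have zV1 : cabs (z^*%C)^-1 < 1 by rewrite cabsV cabsJ invf_lt1 // (lt_trans _ z1).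
have := log_mean_scale z0 (log_mean_inside zV1); rewrite addr0.
apply: eq_log_mean => t; rewrite cabsM -[cabs z]cabsJ -cabsM mulrBr divff ?conjc_eq0 //.
apply: eq_cabs; apply/eqP; rewrite -(@eqrXn2 _ 2) // sqr_norm_reflect.
by rewrite norm_expi expr1n subrr mulr0 addr0.
Qed.

(** The case |z| = 1 is a limit of the two others.  Fatou's lemma along r z with
    r < 1 shows that log|e^(it) - z| is integrable with mean at least 0; as
    |e^(it) - z| <= |e^(it) - q z| for q > 1, the mean is at most log q for all
    such q. *)
Lemma log_mean_on_circle z : cabs z = 1 -> log_mean (fun t => expi t - z) 0.
Proof.
move=> z1; set f := fun t => elog (cabs (expi t - z)).
have mf : measurable_fun circle f.
  by apply: measurable_elog_cabs; exact: ccontinuous_expi_shift.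
(* with this choice log|z - r_k z| = - (k + 1) is explicit *)
pose r k : R := 1 - expR (- k.+1%:R).
have x1 k : expR (- k.+1%:R) < 1 :> R by rewrite expR_lt1 oppr_lt0 ltr0n.
have rz k : cabs ((r k)%:C * z) < 1.
  by rewrite cabsM z1 mulr1 cabs_real ger0_norm ?subr_ge0 ?ltW // ltrBlDr ltrDl expR_gt0.
pose g k t : \bar R := ((ln 2)%:E - elog (cabs (expi t - (r k)%:C * z)%R))%E.
have le2 w t : cabs w <= 1 -> cabs (expi t - w) <= 2.
  by move=> w1; rewrite (le_trans (cabsD _ _)) // cabs_expi cabsN -[2]/(1 + 1) lerD2l.
have elog_le2 w t : cabs w <= 1 -> (elog (cabs (expi t - w)%R) <= (ln 2)%:E)%E.
  by move=> w1; rewrite elog_le_ln // le2.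
have ig k : (\int[mu]_(t in circle) g k t = (2 * pi * ln 2)%:E)%E.
  have [i v] := log_mean_inside (rz k).
  rewrite integralB //; last exact: integrable_circle_cst.
  by rewrite integral_circle_cst v mulr0 sube0.
have h0 t : (0 <= (ln 2)%:E - f t)%E.
  by rewrite subre_ge0 //; apply: elog_le2; rewrite z1.
have mh : measurable_fun circle (fun t => (ln 2)%:E - f t)%E.
  exact: emeasurable_funB.
have limE (u : nat -> \bar R) l : u @ \oo --> l -> limn_einf u = l.
  move=> ul; rewrite is_cvg_limn_einfE; first exact: (cvg_lim (@ereal_hausdorff R) ul).
  by apply/cvg_ex; exists l.
have cg t : g ^~ t @ \oo --> ((ln 2)%:E - f t)%E.
  have [ez|ez] := eqVneq (expi t) z.
    have -> : ((ln 2)%:E - f t = +oo)%E by rewrite /f ez subrr cabs0 elog0.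
    have -> : g ^~ t = EFin \o (fun k => ln 2 + k.+1%:R).
      apply/funext => k; rewrite /g ez /r.
      have -> : z - (1 - expR (- k.+1%:R))%:C * z = (expR (- k.+1%:R))%:C * z.
        by rewrite rmorphB /= rmorph1; ring.
      rewrite cabsM z1 mulr1 cabs_real gtr0_norm ?expR_gt0 //.
      by rewrite elog_gt0 ?expR_gt0 // expRK -EFinB opprK.
    apply/cvgeryP/cvgryPge => A; near=> k.
    rewrite -lerBlDl (@le_trans _ _ k%:R) ?ler_nat //.
    by near: k; exact: nbhs_infty_ger.
  have gt0 k : 0 < cabs (expi t - (r k)%:C * z).
    rewrite cabs_gt0 subr_eq0; apply/eqP => /(congr1 (@cabs R)).
    by rewrite cabs_expi => e; have := rz k; rewrite -e ltxx.
  have -> : g ^~ t = EFin \o (fun k => ln 2 - ln (cabs (expi t - (r k)%:C * z))).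
    by apply/funext => k; rewrite /g elog_gt0.
  rewrite /f elog_gt0 ?cabs_gt0 ?subr_eq0 // -EFinB.
  apply: cvg_EFin; first exact: nearW.
  apply: cvgB; first exact: cvg_cst.
  have cln : {for cabs (expi t - z), continuous (@ln R)}.
    by apply: continuous_ln; rewrite cabs_gt0 subr_eq0.
  have r1 : r k @[k --> \oo] --> (1 : R).
    rewrite -[X in _ --> X]subr0; apply: cvgB; first exact: cvg_cst.
    by rewrite (@cvg_shiftS _ (fun k => expR (- k%:R))); exact: cvgn_expR.
  have ch : continuous (fun s : R => cabs (expi t - s%:C * z)).
    apply: continuous_cabs; apply: ccontinuousD; first exact: ccontinuous_cst.
    rewrite (_ : (fun _ => _) = (fun s : R => s%:C * - z)); last first.
      by apply/funext => s; rewrite mulrN.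
    apply: ccontinuousM (ccontinuous_cst _).
    by split=> x; [exact: cvg_id|exact: cvg_cst].
  have := cvg_comp _ _ r1 (ch 1); rewrite rmorph1 mul1r => cu.
  exact: (cvg_comp _ _ cu cln).
have F : (\int[mu]_(t in circle) ((ln 2)%:E - f t) <= (2 * pi * ln 2)%:E)%E.
  have := @fatou _ _ _ mu circle _ g.
  rewrite (_ : (fun n => \int[mu]_(x in circle) g n x)%E = cst (2 * pi * ln 2)%:E);
    last by apply/funext => k; rewrite ig.
  rewrite (limE _ _ (cvg_cst _)).
  under eq_integral do rewrite (limE _ _ (cg _)).
  apply=> // [k|k t _].
    apply: emeasurable_funB => //; apply: measurable_elog_cabs.
    exact: ccontinuous_expi_shift.
  by rewrite subre_ge0 //; apply: elog_le2; exact: ltW.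
have ih : mu.-integrable circle (fun t => (ln 2)%:E - f t)%E.
  apply/integrableP; split=> //.
  under eq_integral do rewrite gee0_abs //.
  exact: le_lt_trans F (ltry _).
have fE t : f t = ((ln 2)%:E - ((ln 2)%:E - f t))%E.
  have := elog_lty (cabs (expi t - z)); rewrite -/(f t).
  by case: (f t) => // x _; rewrite -!EFinB subKr.
have fi : mu.-integrable circle f.
  rewrite (_ : f = (fun t => (ln 2)%:E - ((ln 2)%:E - f t))%E); last exact/funext.
  apply: integrableB => //; exact: integrable_circle_cst.
split=> //; apply/eqP; rewrite mulr0 eq_le; apply/andP; split.
- apply/lee_addgt0Pr => e e0; rewrite add0e.
  have r1 : 1 < expR (e / (2 * pi)) by rewrite expR_gt1 divr_gt0 ?twopi_gt0.
  set q := expR _ in r1.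
  have qz : cabs (q%:C * z) = q by rewrite cabsM z1 mulr1 cabs_real gtr0_norm ?expR_gt0.
  have [i v] : log_mean (fun t => expi t - q%:C * z) (ln q).
    by rewrite -{2}qz; apply: log_mean_outside; rewrite qz.
  have -> : e = 2 * pi * ln q by rewrite expRK mulrCA divff ?mulr1 // gt_eqF ?twopi_gt0.
  rewrite -v; apply: le_integral => // t _; apply: le_elog.
  rewrite le_cabs lec_norm; have := cos2Dsin2 t.
  have : complex.Re z ^+ 2 + complex.Im z ^+ 2 = 1.
    by apply: (@complexI R); rewrite add_Re2_Im2 -cabsE z1 expr1n.
  clear -r1; case: z => x y /=; move: (cos t) (sin t) => c s xy cs.
  rewrite !mul0r subr0 addr0.
  have d1 : c * x + s * y <= 1.
    have := addr_ge0 (sqr_ge0 (c - x)) (sqr_ge0 (s - y)); rewrite !sqrrB; lra.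
  have : 0 <= (q - 1) * (q + 1 - 2 * (c * x + s * y)) by rewrite mulr_ge0 ?subr_ge0; lra.
  have : q ^+ 2 * (x ^+ 2 + y ^+ 2) = q ^+ 2 by rewrite xy mulr1.
  by nra.
- have -> : (\int[mu]_(t in circle) elog (cabs (expi t - z)%R) =
    \int[mu]_(t in circle) ((ln 2)%:E - ((ln 2)%:E - f t)))%E.
    by apply: eq_integral => t _; exact: fE.
  rewrite integralB //; last exact: integrable_circle_cst.
  by rewrite integral_circle_cst subre_ge0.
Unshelve. all: by end_near. Qed.

End Jensen.

Section JensenPolynomials.
Variable R : realType.
Local Notation C := R[i].
Local Notation mu := (@lebesgue_measure R).
Local Notation circle := (`[0, 2 * pi]%classic : set R).
Implicit Types (z w a b d : C) (s t : R) (P F G : {poly C}) (n : nat).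

Lemma log_meanM (f g : R -> C) u v : log_mean f u -> log_mean g v ->
  log_mean (fun t => f t * g t) (u + v).
Proof.
move=> [fi fu] [gi gv]; rewrite /log_mean.
suff -> : (fun t => elog (cabs (f t * g t))) =
  (fun t => elog (cabs (f t)) + elog (cabs (g t)))%E.
  split; first by apply: integrableD.
  by rewrite integralD // fu gv -EFinD -mulrDr.
by apply/funext => t; rewrite cabsM elogM ?cabs_ge0.
Qed.

Lemma log_mean_cst (c : C) : c != 0 -> log_mean (fun=> c) (ln (cabs c)).
Proof.
move=> c0; rewrite /log_mean elog_gt0 ?cabs_gt0 // integral_circle_cst.
by split=> //; exact: integrable_circle_cst.
Qed.

Lemma jensen z : log_mean (fun t => expi t - z) (ln (Num.max 1 (cabs z))).
Proof.
have [z1|z1|z1] := ltrgtP (cabs z) 1.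
- by rewrite ln1; exact: log_mean_inside.
- exact: log_mean_outside.
- by rewrite z1 ln1; exact: log_mean_on_circle.
Qed.

Lemma jensen_affine a b : a != 0 ->
  log_mean (fun t => a * expi t + b) (ln (Num.max (cabs a) (cabs b))).
Proof.
move=> a0; have := log_mean_scale a0 (jensen (- (b / a))).
rewrite -lnM ?posrE ?cabs_gt0 ?lt_max ?ltr01 //.
rewrite maxr_pMr ?cabs_ge0 // mulr1 -cabsM mulrN cabsN mulrCA divff // mulr1.
apply: eq_log_mean => t; congr cabs.
by rewrite mulrDr opprK mulrCA divff // mulr1.
Qed.

(** By Jensen's formula, roots in the closed disk contribute nothing. *)
Lemma log_mean_roots_in_disk n G : roots_in_disk n G ->
  log_mean (fun t => G.[expi t]) (ln (cabs G`_n)).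
Proof.
move=> Gn; have [sG _] := Gn; have [s [_ s1 Gs]] := roots_in_disk_prod Gn.
have Gc : lead_coef G = G`_n by rewrite lead_coefE sG.
have c0 : G`_n != 0 by rewrite -Gc lead_coef_eq0 -size_poly_gt0 sG.
have -> : (fun t => G.[expi t]) = (fun t => G`_n * \prod_(a <- s) (expi t - a)).
  apply/funext => t; rewrite {1}Gs hornerZ Gc horner_prod; congr (_ * _).
  by apply: eq_bigr => a _; rewrite hornerXsubC.
rewrite -[ln _]addr0; apply: log_mean_scale => //.
elim: s s1 {Gs} => [_|a s IHs /= /andP[a1 /IHs {}IHs]].
  have := log_mean_cst (oner_neq0 C); rewrite cabs1 ln1.
  by apply: eq_log_mean => t; rewrite big_nil.
have a1' : cabs a <= 1 by rewrite -[1](@cabs1 R) le_cabs normr1.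
have := log_meanM (jensen a) IHs; rewrite (max_idPl a1') ln1 addr0.
by apply: eq_log_mean => t; rewrite big_cons.
Qed.

Lemma horner_expi_bounded P : exists2 B, 0 < B & forall t, cabs P.[expi t] <= B.
Proof.
elim/poly_ind: P => [|P c [B B0 PB]].
  by exists 1 => // t; rewrite horner0 cabs0.
exists (B + cabs c + 0); first by rewrite addr0 ltr_wpDr ?cabs_ge0.
move=> t; rewrite addr0 hornerMXaddC (le_trans (cabsD _ _)) // lerD2r.
by rewrite cabsM cabs_expi mulr1.
Qed.

End JensenPolynomials.

(** * Tonelli's theorem on subsets of the line *)

Section Tonelli.
Variable R : realType.
Local Notation mu := (@lebesgue_measure R).

(** Tonelli's theorem for Lebesgue measure restricted to A and to B: extend the
    integrand by 0 outside A x B. *)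
Lemma tonelli_lebesgue (A B : set R) (f : R * R -> \bar R) :
  measurable A -> measurable B ->
  measurable_fun [set: R * R] f -> (forall x, 0 <= f x)%E ->
  (\int[mu]_(x in A) \int[mu]_(y in B) f (x, y) =
   \int[mu]_(y in B) \int[mu]_(x in A) f (x, y))%E.
Proof.
move=> mA mB mf f0; set g := f \_ (A `*` B).
have mg : measurable_fun [set: R * R] g.
  apply/(measurable_restrictT _ _).1; first exact: measurableX.
  exact: measurable_funTS.
have g0 p : (0 <= g p)%E by rewrite /g patchE; case: ifP.
have gA x y : A x -> g (x, y) = ((fun y => f (x, y)) \_ B) y.
  move=> Ax; rewrite /g !patchE; congr (if _ then _ else _).
  by apply/idP/idP; rewrite !inE //= => -[].
have gB x y : B y -> g (x, y) = ((fun x => f (x, y)) \_ A) x.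
  move=> By; rewrite /g !patchE; congr (if _ then _ else _).
  by apply/idP/idP; rewrite !inE //= => -[].
have gA0 x y : ~ A x -> g (x, y) = 0%E.
  by move=> Ax; rewrite /g patchE ifF //; apply/negP; rewrite inE /= => -[].
have gB0 x y : ~ B y -> g (x, y) = 0%E.
  by move=> By; rewrite /g patchE ifF //; apply/negP; rewrite inE /= => -[].
rewrite [LHS]integral_mkcond [RHS]integral_mkcond.
transitivity (\int[mu]_x \int[mu]_y g (x, y))%E.
  apply: eq_integral => x _; rewrite patchE; case: ifPn => [|/negP] Ax.
    rewrite integral_mkcond; apply: eq_integral => y _.
    by rewrite gA //; rewrite inE in Ax.
  by rewrite integral0_eq // => y _; rewrite gA0 // => /mem_set.
rewrite fubini_tonelli //.
apply: eq_integral => y _; rewrite patchE; case: ifPn => [|/negP] By.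
  rewrite [RHS]integral_mkcond; apply: eq_integral => x _.
  by rewrite gB //; rewrite inE in By.
by rewrite integral0_eq // => x _; rewrite gB0 // => /mem_set.
Qed.

Lemma measurable_fun_tonelli (A : set R) (f : R * R -> \bar R) :
  measurable A -> measurable_fun [set: R * R] f -> (forall x, 0 <= f x)%E ->
  measurable_fun setT (fun y => \int[mu]_(x in A) f (x, y))%E.
Proof.
move=> mA mf f0; set g := f \_ (A `*` setT).
have mg : measurable_fun [set: R * R] g.
  apply/(measurable_restrictT _ _).1; first exact: measurableX.
  exact: measurable_funTS.
have g0 p : (0 <= g p)%E by rewrite /g patchE; case: ifP.
have := @measurable_fun_fubini_tonelli_G _ _ _ _ _ mu _ mg g0.
congr measurable_fun; apply/funext => y; rewrite [RHS]integral_mkcond.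
apply: eq_integral => x _; rewrite /g !patchE; congr (if _ then _ else _).
by apply/idP/idP; rewrite !inE //= => -[].
Qed.

End Tonelli.

(** * The mean of log max(|P|, s) *)

Section Arestov.
Variable R : realType.
Local Notation C := R[i].
Local Notation mu := (@lebesgue_measure R).
Local Notation circle := (`[0, 2 * pi]%classic : set R).
Implicit Types (z w a b d : C) (s t : R) (P F G : {poly C}).

Lemma log_mean_integralB f v (K : R) : log_mean f v ->
  (\int[mu]_(t in circle) (K%:E - elog (cabs (f t))) = (2 * pi * (K - v))%:E)%E.
Proof.
move=> [fi fv]; rewrite integralB //; last exact: integrable_circle_cst.
by rewrite integral_circle_cst fv -EFinB -mulrBr.
Qed.

Lemma measurable_subelog (f : R -> C) (K : R) : ccontinuous f ->
  measurable_fun circle (fun t => K%:E - elog (cabs (f t)))%E.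
Proof. by move=> cf; apply: emeasurable_funB => //; exact: measurable_elog_cabs. Qed.

Lemma ccontinuous_horner_expi P : ccontinuous (fun t => P.[expi t] : C).
Proof. by apply: ccontinuous_horner; exact: ccontinuous_expi. Qed.

Variables (n : nat) (d : C).
Hypotheses (n0 : (0 < n)%N) (dn : complex.Re d <= n%:R / 2).
Local Notation T := (euler_op ('X - d%:P)).
Let c := cabs (n%:R - d).

Let c_gt0 : 0 < c. Proof. by rewrite cabs_gt0 natr_sub_neq0. Qed.

Lemma euler_op_majorant F : F != 0 -> (size F <= n.+1)%N ->
  exists G, [/\ roots_in_disk n G, forall t, cabs F.[expi t] = cabs G.[expi t],
    roots_in_disk n (T G) & forall t, cabs (T F).[expi t] <= cabs (T G).[expi t]].
Proof.
move=> F0 sF; have [G [Gn FGn FG FGe]] := flip_roots F0 sF.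
exists G; split=> // [t||t].
- by apply: eq_cabs; rewrite FGe // norm_expi.
- exact: (roots_in_disk_euler n0 dn Gn).
- rewrite le_cabs; apply: horner_norm_le_closed; last by rewrite norm_expi.
  exact: (euler_op_dominated n0 dn sF Gn FGn FG).
Qed.

Lemma ln_lead_euler G : roots_in_disk n G ->
  ln (cabs (T G)`_n) = ln c + ln (cabs G`_n).
Proof.
move=> [sG _]; rewrite coef_euler_op hornerXsubC cabsM lnM ?posrE //.
by rewrite cabs_gt0 -[G`_n]/(G`_(n.+1.-1)) -sG -lead_coefE lead_coef_eq0 -size_poly_gt0 sG.
Qed.

(** The inequality M(TF) <= |n - d| M(F), stated for the functions
    K - log|TF| and K - log|n - d| - log|F|.  In this form it remains true for
    F = 0 or TF = 0, with infinite integrals, so that it can be integrated over a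
    family of polynomials F. *)
Lemma log_integral_euler_le F (K : R) : (size F <= n.+1)%N ->
  (forall t, elog (cabs (T F).[expi t]) <= K%:E)%E ->
  (\int[mu]_(t in circle) ((K - ln c)%:E - elog (cabs F.[expi t])) <=
   \int[mu]_(t in circle) (K%:E - elog (cabs (T F).[expi t])))%E.
Proof.
move=> sF TFK.
have mT : measurable_fun circle (fun t => K%:E - elog (cabs (T F).[expi t]))%E.
  by apply: measurable_subelog; exact: ccontinuous_horner_expi.
have h0 t : (0 <= K%:E - elog (cabs (T F).[expi t]))%E by rewrite subre_ge0.
have [F0|F0] := eqVneq F 0.
  have e (k : R) : (\int[mu]_(t in circle) (k%:E - elog (cabs (0 : {poly C}).[expi t])%R) =
      \int[mu]_(t in circle) +oo)%E.
    by apply: eq_integral => t _; rewrite horner0 cabs0 elog0.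
  by rewrite F0 euler_op0 !e.
have [G [Gn FG TGn TFG]] := euler_op_majorant F0 sF.
have [->|hfin] := eqVneq
  (\int[mu]_(t in circle) (K%:E - elog (cabs (T F).[expi t])))%E +oo%E.
  exact: leey.
have hi : mu.-integrable circle (fun t => K%:E - elog (cabs (T F).[expi t]))%E.
  apply/integrableP; split=> //.
  under eq_integral do rewrite gee0_abs //.
  by rewrite ltey.
under eq_integral do rewrite FG.
have LG := log_mean_roots_in_disk Gn; have LTG := log_mean_roots_in_disk TGn.
rewrite (log_mean_integralB _ LG).
have -> : K - ln c - ln (cabs G`_n) = K - ln (cabs (T G)`_n).
  by rewrite ln_lead_euler // opprD addrA.
have <- := log_mean_integralB K LTG.
have iTG : mu.-integrable circle (fun t => K%:E - elog (cabs (T G).[expi t]))%E.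
  by apply: integrableB => //; [exact: integrable_circle_cst|case: LTG].
apply: (le_integral _ iTG hi); first by [].
by move=> t _; exact: leeB (lexx _) (le_elog (TFG t)).
Qed.

End Arestov.

Section ComplexMeasurable.
Variable R : realType.
Local Notation C := R[i].

Definition cmeasurable d (T : measurableType d) (f : T -> C) :=
  measurable_fun setT (fun t => complex.Re (f t)) /\
  measurable_fun setT (fun t => complex.Im (f t)).

Lemma cmeasurableD d (T : measurableType d) (f g : T -> C) :
  cmeasurable f -> cmeasurable g -> cmeasurable (fun t => f t + g t).
Proof.
move=> [rf jf] [rg jg]; split; under eq_fun do rewrite raddfD /=;
  exact: measurable_funD.
Qed.

Lemma cmeasurableM d (T : measurableType d) (f g : T -> C) :
  cmeasurable f -> cmeasurable g -> cmeasurable (fun t => f t * g t).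
Proof.
move=> [rf jf] [rg jg]; split.
  rewrite (_ : (fun _ => _) = (fun t => complex.Re (f t) * complex.Re (g t) -
    complex.Im (f t) * complex.Im (g t))); last first.
    by apply/funext => t; case: (f t); case: (g t).
  by apply: measurable_funB; exact: measurable_funM.
rewrite (_ : (fun _ => _) = (fun t => complex.Re (f t) * complex.Im (g t) +
    complex.Im (f t) * complex.Re (g t))); last first.
  by apply/funext => t; case: (f t); case: (g t).
by apply: measurable_funD; exact: measurable_funM.
Qed.

Lemma cmeasurable_comp d1 d2 (T1 : measurableType d1) (T2 : measurableType d2)
    (f : T2 -> C) (g : T1 -> T2) :
  cmeasurable f -> measurable_fun setT g -> cmeasurable (fun t => f (g t)).
Proof.
move=> [rf jf] mg.
by split; [exact: measurableT_comp rf mg|exact: measurableT_comp jf mg].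
Qed.

Lemma ccontinuous_measurable (f : R -> C) : ccontinuous f -> cmeasurable f.
Proof. by move=> [rf jf]; split; exact: continuous_measurable_fun. Qed.

Lemma measurable_cabs d (T : measurableType d) (f : T -> C) :
  cmeasurable f -> measurable_fun setT (fun t => cabs (f t)).
Proof.
move=> [rf jf]; under eq_fun do rewrite cabs_sqrt !expr2.
apply: (measurableT_comp (f := @Num.sqrt R)).
  by apply: continuous_measurable_fun => x; exact: sqrt_continuous.
by apply: measurable_funD; exact: measurable_funM.
Qed.

Lemma cmeasurable_pencil (f g : R -> C) : ccontinuous f -> ccontinuous g ->
  cmeasurable (fun x : R * R => f x.1 + g x.1 * expi x.2).
Proof.
move=> cf cg; apply: cmeasurableD.
  by apply: cmeasurable_comp; [exact: ccontinuous_measurable|exact: measurable_fst].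
apply: cmeasurableM.
  by apply: cmeasurable_comp; [exact: ccontinuous_measurable|exact: measurable_fst].
apply: cmeasurable_comp; last exact: measurable_snd.
exact/ccontinuous_measurable/ccontinuous_expi.
Qed.

End ComplexMeasurable.

Section Arestov2.
Variable R : realType.
Local Notation C := R[i].
Local Notation mu := (@lebesgue_measure R).
Local Notation circle := (`[0, 2 * pi]%classic : set R).
Implicit Types (z w a b d : C) (s t : R) (P F G : {poly C}).

Lemma continuous_ln_max (h : R -> R) s : 0 < s -> continuous h ->
  continuous (fun t => ln (Num.max (h t) s)).
Proof.
move=> s0 ch; apply: continuous_ln_comp => [x|t]; last by rewrite lt_max s0 orbT.
by apply: (@continuous_max _ _ h (cst s)); [exact: ch|exact: cvg_cst].
Qed.

Lemma Rintegral_circle_subl (h : R -> R) (K : R) : continuous h ->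
  (\int[mu]_(t in circle) (2 * pi * (K - h t))%:E =
   (2 * pi * (2 * pi * K - \int[mu]_(t in circle) h t))%:E)%E.
Proof.
move=> ch; have i := integrable_continuous_itv 0 (2 * pi) ch.
transitivity ((2 * pi)%:E * \int[mu]_(t in circle) (K%:E - (h t)%:E))%E.
  rewrite -integralZl //; last by apply: integrableB => //; exact: integrable_circle_cst.
rewrite integralB //; last exact: integrable_circle_cst.
rewrite integral_circle_cst [RHS]EFinM EFinB; congr (_ * (_ - _))%E.
by rewrite fineK //; exact: integrable_fin_num i.
Qed.

Section DoubleLogIntegral.
Variables (f g : R -> C) (K s : R).
Hypotheses (s0 : 0 < s) (cf : ccontinuous f) (cg : ccontinuous g).
Hypotheses (gs : forall t, cabs (g t) = s) (fK : forall t, cabs (f t) + s <= expR K).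

Let h (x : R * R) : \bar R := (K%:E - elog (cabs (f x.1 + g x.1 * expi x.2)%R))%E.

Let elog_leK t y : (elog (cabs (f t + g t * expi y)%R) <= K%:E)%E.
Proof.
rewrite -[K]expRK elog_le_ln ?expR_gt0 //.
by rewrite (le_trans _ (fK t)) // (le_trans (cabsD _ _)) // cabsM cabs_expi mulr1 gs.
Qed.

Let h_ge0 x : (0 <= h x)%E.
Proof. by rewrite subre_ge0. Qed.

Let mh : measurable_fun [set: R * R] h.
Proof.
apply: emeasurable_funB => //; apply: measurableT_comp => //.
by apply: measurable_cabs; exact: cmeasurable_pencil.
Qed.

Lemma measurable_log_pencil : measurable_fun circle (fun y =>
  \int[mu]_(t in circle) (K%:E - elog (cabs (f t + g t * expi y)%R)))%E.
Proof. by apply: measurable_funTS; exact: (measurable_fun_tonelli _ mh h_ge0). Qed.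

Lemma log_pencil_ge0 y :
  (0 <= \int[mu]_(t in circle) (K%:E - elog (cabs (f t + g t * expi y)%R)))%E.
Proof. by apply: integral_ge0 => t _; exact: (h_ge0 (t, y)). Qed.

(** Averaging log|f + e^(iy) g| over y turns it into log max(|f|, |g|); Tonelli
    applies since K - log|f + e^(iy) g| is nonnegative for K large. *)
Lemma double_log_integral :
  (\int[mu]_(y in circle) \int[mu]_(t in circle)
     (K%:E - elog (cabs (f t + g t * expi y)%R)) =
   (2 * pi * (2 * pi * K - \int[mu]_(t in circle) ln (Num.max (cabs (f t)) s)))%:E)%E.
Proof.
rewrite -(tonelli_lebesgue _ _ mh h_ge0) //.
rewrite -Rintegral_circle_subl; last first.
  by apply: continuous_ln_max => //; exact: continuous_cabs.
apply: eq_integral => t _.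
have gt0 : g t != 0 by rewrite -cabs_gt0 gs.
rewrite maxC -(gs t) -(log_mean_integralB _ (jensen_affine (f t) gt0)).
by apply: eq_integral => y _; rewrite /h /= [f t + _]addrC.
Qed.
End DoubleLogIntegral.

Section EulerMean.
Variables (n : nat) (d : C).
Hypotheses (n0 : (0 < n)%N) (dn : complex.Re d <= n%:R / 2).
Local Notation T := (euler_op ('X - d%:P)).
Local Notation c := (cabs (n%:R - d)).

(** Apply [log_integral_euler_le] to P + s e^(iy) z^n and integrate over y.  It is
    the choice of the monomial z^n, and not of a constant, that makes the factor
    |n - d| appear on the left as well. *)
Lemma mean_ln_max_euler P s : (size P <= n.+1)%N -> 0 < s ->
  \int[mu]_(t in circle) ln (Num.max (cabs (T P).[expi t] / c) s) <=
  \int[mu]_(t in circle) ln (Num.max (cabs P.[expi t]) s).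
Proof.
move=> sP s0; have c0 : 0 < c by rewrite cabs_gt0 natr_sub_neq0.
have [B1 B10 PB] := horner_expi_bounded P.
have [B2 B20 TPB] := horner_expi_bounded (T P).
(* large enough for the integrands K - ln c - log|F| and K - log|T F| below to be
   nonnegative for all parameters *)
pose K := Num.max (ln c + ln (B1 + s)) (ln (B2 + c * s)).
pose g (a : C) t : C := a * expi t ^+ n.
have cg a : ccontinuous (g a).
  have := ccontinuousM (@ccontinuous_cst _ a) (ccontinuous_horner_expi 'X^n).
  by congr ccontinuous; apply/funext => t; rewrite hornerXn.
have gE a t : cabs (g a t) = cabs a.
  by rewrite cabsM cabsX cabs_expi expr1n mulr1.
have cs : cabs s%:C = s by rewrite cabs_real gtr0_norm.
have g1 t : cabs (g s%:C t) = s by rewrite gE.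
have g2 t : cabs (g ((n%:R - d) * s%:C) t) = c * s by rewrite gE cabsM cs.
have cs0 : 0 < c * s by exact: mulr_gt0.
have K1 t : cabs P.[expi t] + s <= expR (K - ln c).
  rewrite (@le_trans _ _ (B1 + s)) ?lerD2r //.
  rewrite -ler_ln ?posrE ?expR_gt0 ?addr_gt0 // expRK lerBrDl.
  by rewrite le_max lexx.
have K2 t : cabs (T P).[expi t] + c * s <= expR K.
  rewrite (@le_trans _ _ (B2 + c * s)) ?lerD2r //.
  by rewrite -ler_ln ?posrE ?expR_gt0 ?addr_gt0 // expRK le_max lexx orbT.
have cP := ccontinuous_horner_expi P; have cTP := ccontinuous_horner_expi (T P).
have I1 := double_log_integral s0 cP (cg _) g1 K1.
have I2 := double_log_integral cs0 cTP (cg _) g2 K2.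
have m1 := measurable_log_pencil cP (cg _) g1 K1.
have m2 := measurable_log_pencil cTP (cg _) g2 K2.
have p1 := log_pencil_ge0 g1 K1.
have p2 := log_pencil_ge0 g2 K2.
have : ((2 * pi * (2 * pi * (K - ln c) -
    \int[mu]_(t in circle) ln (Num.max (cabs P.[expi t]) s)))%:E <=
  (2 * pi * (2 * pi * K -
    \int[mu]_(t in circle) ln (Num.max (cabs (T P).[expi t]) (c * s))))%:E)%E.
  rewrite -I1 -I2; apply: ge0_le_integral => // y _.
  pose F := P + (s%:C * expi y) *: 'X^n.
  have FE t : F.[expi t] = P.[expi t] + g s%:C t * expi y.
    by rewrite hornerD hornerZ hornerXn /g; ring.
  have TFE t : (T F).[expi t] = (T P).[expi t] + g ((n%:R - d) * s%:C) t * expi y.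
    rewrite euler_opDr euler_opZr euler_opXn hornerXsubC hornerD !hornerZ hornerXn.
    by rewrite /g; ring.
  have sF : (size F <= n.+1)%N.
    rewrite (leq_trans (size_polyD _ _)) // geq_max sP.
    by rewrite (leq_trans (size_scale_leq _ _)) // size_polyXn.
  have TFK t : (elog (cabs (T F).[expi t]) <= K%:E)%E.
    rewrite TFE -[K]expRK elog_le_ln ?expR_gt0 // (le_trans _ (K2 t)) //.
    by rewrite (le_trans (cabsD _ _)) // cabsM cabs_expi mulr1 g2.
  have := log_integral_euler_le n0 dn sF TFK.
  under eq_integral do rewrite FE.
  by under [X in (_ <= X)%E -> _]eq_integral do rewrite TFE.
rewrite lee_fin ler_pM2l ?twopi_gt0 // => le12.
have -> : \int[mu]_(t in circle) ln (Num.max (cabs (T P).[expi t] / c) s) =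
  \int[mu]_(t in circle) ln (Num.max (cabs (T P).[expi t]) (c * s)) - 2 * pi * ln c.
  have i1 : mu.-integrable circle
      (EFin \o (fun t => ln (Num.max (cabs (T P).[expi t]) (c * s)))).
    apply: integrable_continuous_itv; apply: continuous_ln_max => //.
    exact: continuous_cabs.
  have i2 := integrable_circle_cst (ln c).
  have -> : 2 * pi * ln c = \int[mu]_(t in circle) ln c.
    by rewrite /Rintegral integral_circle_cst.
  rewrite -RintegralB //; apply: eq_Rintegral => t _.
  have -> : Num.max (cabs (T P).[expi t]) (c * s) =
      c * Num.max (cabs (T P).[expi t] / c) s.
    by rewrite maxr_pMr ?ltW // mulrCA divff ?gt_eqF // mulr1.
  by rewrite lnM ?posrE ?lt_max ?s0 ?orbT // addrAC subrr add0r.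
move: le12; set I := \int[mu]_(t in _) _; set J := \int[mu]_(t in _) _.
set L := 2 * pi; lra.
Qed.

End EulerMean.
End Arestov2.

(** * From logarithmic means to power means *)

Section PowerMean.
Variable R : realType.
Local Notation mu := (@lebesgue_measure R).
Local Notation circle := (`[0, 2 * pi]%classic : set R).
Variable p : R.
Hypothesis p0 : 0 < p.

(** The kernel expressing x^p, for 0 <= x <= 1, as a superposition of the functions
    log max(x, s) - log s; here s = e^(-y) with y >= 0, so that only one
    integral over a half-line occurs. *)
Definition ln_layer (x y : R) : R :=
  p ^+ 2 * expR (- p * y) * (ln (Num.max x (expR (- y))) + y).

Lemma ln_layer_ge0 x y : 0 <= ln_layer x y.
Proof.
apply: mulr_ge0; first by rewrite mulr_ge0 ?sqr_ge0 ?expR_ge0.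
rewrite -lerBlDr sub0r -[leLHS]expRK ler_ln ?posrE ?expR_gt0 ?lt_max ?expR_gt0 ?orbT //.
by rewrite le_max lexx orbT.
Qed.

Lemma cvg_layer_primitive Y : 0 <= Y ->
  (- (p * (y - Y) + 1) * expR (- p * y)) @[y --> +oo] --> (0 : R).
Proof.
move=> Y0; apply/norm_cvg0P.
have lim : 2 * expR (- (p / 2 * y)) @[y --> +oo] --> (0 : R).
  rewrite -[X in _ --> X](mulr0 2); apply: cvgMr.
  apply: (cvg_comp (fun y => p / 2 * y) (fun y => expR (- y))); last exact: cvgr_expR.
  apply: gt0_cvgMry; [by rewrite divr_gt0|exact: cvg_id].
apply: squeeze_cvgr lim; last exact: cvg_cst.
near=> y; rewrite normr_ge0 /= normrM normrN.
have Yy : Y <= y by near: y; apply: nbhs_pinfty_ge; exact: num_real.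
(* p (y - Y) + 1 <= 2 e^(p y / 2): half of the decay absorbs the linear factor *)
have e1 := @expR_ge1Dx R (p / 2 * y).
have py : 0 <= p * (y - Y) + 1 by rewrite addr_ge0 // mulr_ge0 ?subr_ge0 // ltW.
rewrite !ger0_norm ?expR_ge0 //.
have -> : expR (- p * y) = expR (- (p / 2 * y)) * expR (- (p / 2 * y)).
  by rewrite -expRD; congr expR; field.
rewrite mulrA ler_wpM2r ?expR_ge0 // expRN ler_pdivrMr ?expR_gt0 //.
have pY : 0 <= p * Y by rewrite mulr_ge0 // ltW.
rewrite mulrBr; lra.
Unshelve. all: by end_near. Qed.

(** The integrand vanishes for y < - ln x and equals p^2 e^(-py) (y + ln x) beyond,
    with the primitive - (p (y + ln x) + 1) e^(-py). *)
Lemma integral_ln_layer x : 0 <= x <= 1 ->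
  (\int[mu]_(y in `[0%R, +oo[) (ln_layer x y)%:E = (x `^ p)%:E)%E.
Proof.
move=> /andP[]; rewrite le0r => /predU1P[-> _|x0 x1].
  rewrite powR0 ?gt_eqF //; apply: integral0_eq => y _; congr EFin.
  by rewrite /ln_layer max_r ?expR_ge0 // expRK addNr mulr0.
pose Y := - ln x; have Y0 : 0 <= Y by rewrite oppr_ge0 ln_le0.
pose f (y : R) : R := p ^+ 2 * expR (- p * y) * (y - Y).
have -> : (\int[mu]_(y in `[0%R, +oo[) (ln_layer x y)%:E =
    \int[mu]_(y in `[Y, +oo[) (f y)%:E)%E.
  have -> : `[Y, +oo[%classic = `[0, +oo[%classic `&` `[Y, +oo[%classic.
    apply/seteqP; split=> y /=; rewrite !in_itv /= !andbT; last by case.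
    by move=> Yy; split=> //; exact: le_trans Yy.
  rewrite integral_mkcondr; apply: eq_integral => y _; rewrite patchE.
  rewrite /ln_layer /f; have [Yy|yY] := leP Y y.
    rewrite ifT; last by rewrite inE /= in_itv /= Yy.
    by rewrite max_l ?opprK 1?[y + _]addrC // -[leRHS]lnK ?posrE // ler_expR lerNl.
  rewrite ifF; last by apply/negP; rewrite inE /= in_itv /= leNgt yY.
  rewrite max_r ?expRK ?addNr ?mulr0 //.
  by rewrite -[leLHS]lnK ?posrE // ler_expR lerNr ltW.
pose F (y : R) : R := - (p * (y - Y) + 1) * expR (- p * y).
have dF (y : R) : is_derive y (1 : R) F (f y).
  rewrite /F /f; apply: is_derive_eq; rewrite /GRing.scale /=.
  ring.
have cf : continuous f.
  move=> y; apply: differentiable_continuous; apply/derivable1_diffP.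
  by rewrite /f; apply: ex_derive.
rewrite (@ge0_continuous_FTC2y _ f F _ 0) //.
- have -> : F Y = - x `^ p.
    by rewrite /F subrr mulr0 add0r mulN1r /Y mulrNN /powR gt_eqF.
  by rewrite -EFinB sub0r opprK.
- by move=> y Yy; rewrite mulr_ge0 ?mulr_ge0 ?expR_ge0 ?exprn_ge0 ?subr_ge0 // ltW.
- exact: continuous_subspaceT.
- exact: cvg_layer_primitive Y0.
- have cF : {for Y, continuous F}.
    by apply: differentiable_continuous; apply/derivable1_diffP.
  exact: cvg_at_right_filter cF.
- by move=> y _; rewrite derive1E; exact: derive_val.
Qed.

Lemma Rintegral_ln_layer (u : R -> R) y : continuous u ->
  (\int[mu]_(t in circle) (ln_layer (u t) y)%:E =
   (p ^+ 2 * expR (- p * y) *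
     (\int[mu]_(t in circle) ln (Num.max (u t) (expR (- y))) + 2 * pi * y))%:E)%E.
Proof.
move=> cu; have cm := continuous_ln_max (expR_gt0 (- y)) cu.
have i := integrable_continuous_itv 0 (2 * pi) cm.
have iy := integrable_circle_cst y.
transitivity ((p ^+ 2 * expR (- p * y))%:E *
  \int[mu]_(t in circle) ((ln (Num.max (u t) (expR (- y))))%:E + y%:E))%E.
  rewrite -integralZl //; last by apply: integrableD.
rewrite integralD // integral_circle_cst [RHS]EFinM EFinD; congr (_ * (_ + _))%E.
by rewrite fineK //; exact: integrable_fin_num i.
Qed.

Lemma measurable_ln_layer (u : R -> R) : continuous u ->
  measurable_fun setT (fun x : R * R => (ln_layer (u x.1) x.2)%:E).
Proof.
move=> cu; have mexp k : measurable_fun setT (fun x : R * R => expR (k * x.2)).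
  apply: measurableT_comp => //; apply: measurable_funM => //; exact: measurable_snd.
apply/measurable_EFinP; apply: measurable_funM.
  by apply: measurable_funM => //; exact: mexp.
apply: measurable_funD; last exact: measurable_snd.
apply: measurableT_comp => //; apply: measurable_maxr.
  apply: measurableT_comp; [exact: continuous_measurable_fun|exact: measurable_fst].
by under eq_fun do rewrite -mulN1r; exact: mexp.
Qed.

(** Exchange the integrals over t and y; the hypothesis then compares the
    integrands for each y, with s = e^(-y). *)
Lemma powR_mean_le1 (u v : R -> R) : continuous u -> continuous v ->
  (forall t, 0 <= u t <= 1) -> (forall t, 0 <= v t <= 1) ->
  (forall s, 0 < s -> \int[mu]_(t in circle) ln (Num.max (u t) s) <=
     \int[mu]_(t in circle) ln (Num.max (v t) s)) ->
  (\int[mu]_(t in circle) (u t `^ p)%:E <= \int[mu]_(t in circle) (v t `^ p)%:E)%E.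
Proof.
move=> cu cv u1 v1 uv.
have swap (w : R -> R) : continuous w -> (forall t, 0 <= w t <= 1) ->
    (\int[mu]_(t in circle) (w t `^ p)%:E =
     \int[mu]_(y in `[0%R, +oo[) \int[mu]_(t in circle) (ln_layer (w t) y)%:E)%E.
  move=> cw w1.
  rewrite -(tonelli_lebesgue _ _ (measurable_ln_layer cw)) //.
    by apply: eq_integral => t _; rewrite /= integral_ln_layer.
  by move=> x; rewrite lee_fin ln_layer_ge0.
have mw (w : R -> R) : continuous w -> measurable_fun (`[0, +oo[%classic : set R)
    (fun y => \int[mu]_(t in circle) (ln_layer (w t) y)%:E)%E.
  move=> cw; apply: measurable_funTS.
  apply: (measurable_fun_tonelli _ (measurable_ln_layer cw)) => //.
  by move=> x; rewrite lee_fin ln_layer_ge0.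
rewrite (swap u cu u1) (swap v cv v1); apply: ge0_le_integral => //.
- by move=> y _; apply: integral_ge0 => t _; rewrite lee_fin ln_layer_ge0.
- exact: mw.
- exact: mw.
move=> y _; rewrite !Rintegral_ln_layer // lee_fin ler_wpM2l ?lerD2r ?uv ?expR_gt0 //.
by rewrite mulr_ge0 ?sqr_ge0 ?expR_ge0.
Qed.

(** Nonnegativity matters: x `^ p is 1 for x < 0. *)
Lemma continuous_powR_comp (u : R -> R) : (forall t, 0 <= u t) ->
  continuous u -> continuous (fun t => u t `^ p).
Proof.
move=> u0 cu x; have := u0 x; rewrite le0r => /predU1P[ux|ux].
  apply/cvgrPdist_lt => e e0; rewrite ux powR0 ?gt_eqF //.
  have /cvgrPdist_lt /(_ (e `^ p^-1) (powR_gt0 _ e0)) := cu x.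
  apply: filterS => t; rewrite ux !sub0r !normrN !ger0_norm ?powR_ge0 // => ute.
  have -> : e = e `^ p^-1 `^ p by rewrite -powRrM mulVf ?gt_eqF // powRr1 // ltW.
  by rewrite gt0_ltr_powR // ?nnegrE // powR_ge0.
have uE t : 0 < u t -> expR (p * ln (u t)) = u t `^ p.
  by move=> ut; rewrite /powR gt_eqF.
rewrite /continuous_at -uE //.
apply: (@cvg_trans _ (expR (p * ln (u t)) @[t --> x])).
  apply: near_eq_cvg; have : \forall t \near x, 0 < u t by exact: (cvgr_gt (u x) (cu x)).
  by apply: filterS => t; exact: uE.
have cln : ln (u t) @[t --> x] --> ln (u x) := cvg_comp _ _ (cu x) (continuous_ln ux).
have cpln : p * ln (u t) @[t --> x] --> p * ln (u x) by apply: cvgM; [exact: cvg_cst|].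
exact: (cvg_comp _ _ cpln (@continuous_expR R _)).
Qed.

Lemma powR_mean_le (u v : R -> R) (B : R) : 0 < B -> continuous u -> continuous v ->
  (forall t, 0 <= u t <= B) -> (forall t, 0 <= v t <= B) ->
  (forall s, 0 < s -> \int[mu]_(t in circle) ln (Num.max (u t) s) <=
     \int[mu]_(t in circle) ln (Num.max (v t) s)) ->
  \int[mu]_(t in circle) (u t `^ p) <= \int[mu]_(t in circle) (v t `^ p).
Proof.
move=> B0 cu cv uB vB uv.
have cB (w : R -> R) : continuous w -> continuous (fun t => w t / B).
  by move=> cw x; apply: cvgM; [exact: cw|exact: cvg_cst].
have i (w : R -> R) : (forall t, 0 <= w t) -> continuous w ->
    mu.-integrable circle (EFin \o (fun t => w t `^ p)).
  by move=> w0 cw; apply: integrable_continuous_itv; exact: continuous_powR_comp.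
have wB1 (w : R -> R) : (forall t, 0 <= w t <= B) -> forall t, 0 <= w t / B <= 1.
  by move=> wB t; have /andP[w0 w1] := wB t; rewrite divr_ge0 ?ler_pdivrMr ?mul1r // ltW.
have le1 : \int[mu]_(t in circle) ((u t / B) `^ p) <=
    \int[mu]_(t in circle) ((v t / B) `^ p).
  have wB0 (w : R -> R) : (forall t, 0 <= w t <= B) -> forall t, 0 <= w t / B.
    by move=> wB t; have /andP[] := wB1 w wB t.
  rewrite /Rintegral fine_le //.
  - by apply: integrable_fin_num => //; apply: i; [exact: wB0|exact: cB].
  - by apply: integrable_fin_num => //; apply: i; [exact: wB0|exact: cB].
  apply: powR_mean_le1; [exact: cB|exact: cB|exact: wB1|exact: wB1|] => s s0.
  have lnE (w : R -> R) : continuous w ->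
      \int[mu]_(t in circle) ln (Num.max (w t / B) s) =
      \int[mu]_(t in circle) ln (Num.max (w t) (s * B)) - 2 * pi * ln B.
    move=> cw; have -> : 2 * pi * ln B = \int[mu]_(t in circle) ln B.
      by rewrite /Rintegral integral_circle_cst.
    rewrite -RintegralB //; last exact: integrable_circle_cst.
      apply: eq_Rintegral => t _.
      have -> : Num.max (w t / B) s = Num.max (w t) (s * B) / B.
        by rewrite maxr_pMl ?invr_ge0 ?ltW // mulfK ?gt_eqF.
      by rewrite ln_div ?posrE ?lt_max ?mulr_gt0 ?orbT.
    apply: integrable_continuous_itv; apply: continuous_ln_max => //.
    exact: mulr_gt0.
  by rewrite !lnE // lerD2r uv // mulr_gt0.
have powE (w : R -> R) : continuous w -> (forall t, 0 <= w t <= B) ->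
    \int[mu]_(t in circle) ((w t / B) `^ p) =
    \int[mu]_(t in circle) (w t `^ p) * B^-1 `^ p.
  move=> cw wB; rewrite -RintegralZr //; last first.
    by apply: i => // t; have /andP[] := wB t.
  apply: eq_Rintegral => t _; have /andP[w0 _] := wB t.
  by rewrite powRM // invr_ge0 ltW.
move: le1; rewrite (powE u cu uB) (powE v cv vB) ler_pM2r //.
by rewrite powR_gt0 // invr_gt0.
Qed.

End PowerMean.

(** * Symbols and self-inversive polynomials *)

Section Symbols.
Variable R : realType.
Local Notation C := R[i].
Implicit Types (z w a b d : C) (s : seq C) (P Q q : {poly C}).
Local Notation Re := (@complex.Re R).

(** z^n conj(P(1 / conj z)) as a polynomial. *)
Definition crev n P : {poly C} := \poly_(k < n.+1) (P`_(n - k))^*%C.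

Lemma horner_crev n P z : (size P <= n.+1)%N -> z != 0 ->
  (crev n P).[z] = z ^+ n * (P.[(z^*%C)^-1])^*%C.
Proof.
move=> sP z0; rewrite (horner_coef_wide _ sP) horner_poly rmorph_sum /= mulr_sumr.
rewrite (reindex_inj rev_ord_inj) /=; apply: eq_bigr => k _.
have kn : (k <= n)%N by rewrite -ltnS.
rewrite subSS subKn // rmorphM rmorphXn /= conjc_inv conjcK.
rewrite mulrCA; congr (_ * _).
by rewrite -[X in z ^+ X * _](subnK kn) exprD exprVn mulfK // expf_neq0.
Qed.

Lemma norm_horner_crev n P z : (size P <= n.+1)%N -> `|z| = 1 ->
  `|(crev n P).[z]| = `|P.[z]|.
Proof.
move=> sP z1; have z0 : z != 0 by rewrite -normr_eq0 z1 oner_eq0.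
rewrite horner_crev // normrM normrX z1 expr1n mul1r normcJ; congr `|_.[_]|.
by rewrite invc_norm normcJ z1 expr1n invr1 mul1r conjcK.
Qed.

Lemma poly_eq_off0 P Q : (forall z, z != 0 -> P.[z] = Q.[z]) -> P = Q.
Proof.
move=> PQ; apply/eqP; rewrite -subr_eq0; apply/negPn/negP => D0.
(* D would have the size D roots 1, 2, 3, and so on *)
set D := P - Q in D0; pose rs : seq C := [seq k.+1%:R | k <- iota 0 (size D)].
have := max_poly_roots D0 (_ : all (root D) rs) (_ : uniq rs).
rewrite size_map size_iota ltnn => H; suff: false by []; apply: H.
  apply/allP => _ /mapP[k _ ->].
  by rewrite rootE hornerD hornerN PQ ?subrr // pnatr_eq0.
rewrite map_inj_uniq ?iota_uniq // => j k /eqP.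
by rewrite eqr_nat eqSS => /eqP.
Qed.

(** The functional equation holds for z != 0, which is enough for an identity of
    polynomials over an infinite field. *)
Lemma self_inversive_crev n P : size P = n.+1 -> self_inversive P ->
  exists2 u, `|u| = 1 & P = u *: crev n P.
Proof.
move=> sP [u u1 Pu]; exists u => //; apply: poly_eq_off0 => z z0.
by rewrite hornerZ horner_crev ?sP // {1}Pu // sP mulrA.
Qed.

Definition symbol s := \prod_(a <- s) ('X - a%:P).
(** Its value at k is the conjugate of the symbol at n - conj k. *)
Definition conj_symbol n s := \prod_(a <- s) ((n%:R - a^*%C)%:P - 'X).

Lemma horner_symbol s z : (symbol s).[z] = \prod_(a <- s) (z - a).
Proof. by rewrite horner_prod; apply: eq_bigr => a _; rewrite !hornerE. Qed.

Lemma horner_conj_symbol n s z :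
  (conj_symbol n s).[z] = \prod_(a <- s) (n%:R - a^*%C - z).
Proof. by rewrite horner_prod; apply: eq_bigr => a _; rewrite !hornerE. Qed.

Lemma conj_symbol_nat n s k : (k <= n)%N ->
  (conj_symbol n s).[k%:R] = ((symbol s).[(n - k)%:R])^*%C.
Proof.
move=> kn; rewrite horner_conj_symbol horner_symbol rmorph_prod.
by apply: eq_bigr => a _; rewrite rmorphB /= conjc_nat natrB // addrAC.
Qed.

(** For q the symbol and r its conjugate, r(zD) is conjugate to q(zD) under
    conjugate reversal, which fixes P up to a unimodular factor and preserves
    moduli on the circle. *)
Lemma euler_conj_symbol n s P : size P = n.+1 -> self_inversive P ->
  forall z, `|z| = 1 -> `|(euler_op (conj_symbol n s) P).[z]| =
    `|(euler_op (symbol s) P).[z]|.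
Proof.
move=> sP siP z z1; have [u u1 Pu] := self_inversive_crev sP siP.
rewrite -[RHS](@norm_horner_crev n) ?size_euler_op ?sP //.
have -> : euler_op (conj_symbol n s) P = u *: crev n (euler_op (symbol s) P).
  apply/polyP => k; rewrite coef_euler_op coefZ coef_poly.
  case: ltnP => [kn|kn]; last by rewrite nth_default ?mulr0 // sP.
  rewrite conj_symbol_nat // {1}Pu coefZ coef_poly kn coef_euler_op rmorphM /=.
  by rewrite mulrCA.
by rewrite hornerZ normrM u1 mul1r.
Qed.

(** Each factor decreases the distance, as reflection about Re = n/2 moves a closer
    to z.  Equality of the products forces equality in every factor, hence
    Re a = n/2 for all a, and then both products have the same factors up to sign. *)
Lemma conj_symbol_le n s z : all (fun a => Re a <= n%:R / 2) s -> n%:R / 2 < Re z ->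
  [/\ (symbol s).[z] != 0, `|(conj_symbol n s).[z]| <= `|(symbol s).[z]|
    & `|(conj_symbol n s).[z]| = `|(symbol s).[z]| ->
      exists c, conj_symbol n s = c *: symbol s].
Proof.
move=> sn nz; elim: s sn => [_|a s IHs /= /andP[an /IHs[{IHs} s0 sle seq]]].
  rewrite /conj_symbol /symbol !big_nil hornerC oner_eq0; split=> // _.
  by exists 1; rewrite scale1r.
have za : z - a != 0.
  by rewrite subr_eq0; apply: contraTneq nz => ->; rewrite -leNgt.
have ale : `|n%:R - a^*%C - z| <= `|z - a|.
  by rewrite distrC; exact: le_dist_reflect.
have aeq : `|n%:R - a^*%C - z| = `|z - a| -> (n%:R - a^*%C)%:P - 'X = - ('X - a%:P).
  move=> e; have : ~~ (Re a < n%:R / 2).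
    apply/negP => /(lt_dist_reflect nz); rewrite distrC e ltxx //.
  rewrite -leNgt => na; have {na an} aE : Re a = n%:R / 2.
    by apply: le_anti; rewrite an.
  rewrite opprB; congr (_%:P - _); case: a aE {e za ale} => x y /= ->.
  rewrite -(rmorph_nat (real_complex R)); apply/eqP; rewrite eq_complex /=.
  by rewrite opprK add0r eqxx andbT; apply/eqP; field.
rewrite /symbol /conj_symbol !big_cons !hornerM -/(symbol s) -/(conj_symbol n s).
rewrite !hornerE !normrM; split; first by rewrite mulf_neq0.
  by rewrite ler_pM.
move=> e; have e1 : `|n%:R - a^*%C - z| = `|z - a|.
  apply: le_anti; rewrite ale /= -(ler_pM2r (_ : 0 < `|(symbol s).[z]|)) ?normr_gt0 //.
  by rewrite -e ler_wpM2l.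
have [|c ->] := seq.
  by apply: (mulfI (_ : `|z - a| != 0)); rewrite ?normr_eq0 // -e e1.
by exists (- c); rewrite aeq // -scalerAr mulNr scaleNr scalerN.
Qed.

(** At a root with Re > n/2 the moduli of the symbol and of its conjugate agree.
    By [conj_symbol_le] these are then proportional, so that the symbol itself
    would vanish there. *)
Lemma pencil_root n s w z : all (fun a => Re a <= n%:R / 2) s -> `|w| = 1 ->
  symbol s + w *: conj_symbol n s != 0 ->
  root (symbol s + w *: conj_symbol n s) z -> Re z <= n%:R / 2.
Proof.
move=> sn w1 Q0 /rootP; rewrite hornerD hornerZ => Qz.
rewrite leNgt; apply/negP => nz; have [s0 _ seq] := conj_symbol_le sn nz.
have [|c cE] := seq.
  have -> : (symbol s).[z] = - (w * (conj_symbol n s).[z]).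
    by apply/eqP; rewrite -addr_eq0 Qz.
  by rewrite normrN normrM w1 mul1r.
have QE : symbol s + w *: conj_symbol n s = (1 + w * c) *: symbol s.
  by rewrite cE scalerDl scale1r scalerA.
move: Q0 Qz; rewrite -hornerZ -hornerD QE hornerZ => Q0 /eqP.
rewrite mulf_eq0 (negPf s0) orbF => /eqP c0.
by rewrite c0 scale0r eqxx in Q0.
Qed.

End Symbols.

(** * The inequality for positive exponents *)

Section PowerNorms.
Variable R : realType.
Local Notation C := R[i].
Local Notation mu := (@lebesgue_measure R).
Local Notation circle := (`[0, 2 * pi]%classic : set R).
Implicit Types (a b c d z w : C) (s : seq C) (P Q q : {poly C}).
Local Notation Re := (@complex.Re R).
Variable p : R.
Hypothesis p0 : 0 < p.

Definition powR_integral (f : R -> C) : R := \int[mu]_(t in circle) (cabs (f t) `^ p).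

Lemma continuous_cabs_powR (f : R -> C) : ccontinuous f ->
  continuous (fun t => cabs (f t) `^ p).
Proof.
by move=> cf; apply: continuous_powR_comp => // [t|];
  [exact: cabs_ge0|exact: continuous_cabs].
Qed.

Lemma integrable_cabs_powR (f : R -> C) : ccontinuous f ->
  mu.-integrable circle (EFin \o (fun t => cabs (f t) `^ p)).
Proof. by move=> cf; apply: integrable_continuous_itv; exact: continuous_cabs_powR. Qed.

Lemma powR_integral_ge0 f : 0 <= powR_integral f.
Proof. by apply: Rintegral_ge0 => t _; exact: powR_ge0. Qed.

Lemma powR_integral_cst c : powR_integral (fun=> c) = 2 * pi * cabs c `^ p.
Proof. by rewrite /powR_integral /Rintegral integral_circle_cst. Qed.

Lemma powR_integralZ c (f : R -> C) : ccontinuous f ->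
  powR_integral (fun t => c * f t) = cabs c `^ p * powR_integral f.
Proof.
move=> cf; rewrite /powR_integral -RintegralZl //; last exact: integrable_cabs_powR.
by apply: eq_Rintegral => t _; rewrite cabsM powRM ?cabs_ge0.
Qed.

Lemma euler_powR_integral_le n d P : (0 < n)%N -> Re d <= n%:R / 2 -> (size P <= n.+1)%N ->
  powR_integral (fun t => (euler_op ('X - d%:P) P).[expi t]) <=
  cabs (n%:R - d) `^ p * powR_integral (fun t => P.[expi t]).
Proof.
move=> n0 dn sP; set TP := euler_op _ P; set c := n%:R - d.
have c0 : 0 < cabs c by rewrite cabs_gt0 natr_sub_neq0.
have cTP := ccontinuous_horner_expi TP; have cP := ccontinuous_horner_expi P.
have [B1 B10 PB] := horner_expi_bounded P.
have [B2 B20 TPB] := horner_expi_bounded TP.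
have B0 : 0 < B1 + B2 / cabs c by rewrite addr_gt0 ?divr_gt0.
have := @powR_mean_le _ p p0
  (fun t => cabs TP.[expi t] / cabs c) (fun t => cabs P.[expi t]) _ B0.
have cu : continuous (fun t => cabs TP.[expi t] / cabs c).
  by move=> x; apply: cvgM; [exact: continuous_cabs|exact: cvg_cst].
have uB t : 0 <= cabs TP.[expi t] / cabs c <= B1 + B2 / cabs c.
  rewrite divr_ge0 ?cabs_ge0 //= (@le_trans _ _ (B2 / cabs c)) ?lerDr ?(ltW B10) //.
  by rewrite ler_pM2r ?invr_gt0.
have vB t : 0 <= cabs P.[expi t] <= B1 + B2 / cabs c.
  by rewrite cabs_ge0 (le_trans (PB t)) // lerDl divr_ge0 ?ltW.
move=> /(_ cu (continuous_cabs cP) uB vB (fun r r0 => mean_ln_max_euler n0 dn sP r0)).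
move=> /(ler_wpM2r (powR_ge0 (cabs c) p)) le_uv.
rewrite mulrC; apply: le_trans le_uv; rewrite -RintegralZr //; last first.
  apply: integrable_continuous_itv; apply: continuous_powR_comp => // t.
  by have /andP[] := uB t.
rewrite le_eqVlt; apply/orP; left; apply/eqP; apply: eq_Rintegral => t _.
by rewrite -powRM ?divr_ge0 ?cabs_ge0 // divfK // gt_eqF.
Qed.

(** A nonzero q is a constant times a product of linear factors; the first-order
    inequality is applied once for each factor. *)
Lemma symbol_powR_integral_le n q P : (0 < n)%N -> (size P <= n.+1)%N ->
  (q != 0 -> forall z, root q z -> Re z <= n%:R / 2) ->
  powR_integral (fun t => (euler_op q P).[expi t]) <=
  cabs q.[n%:R] `^ p * powR_integral (fun t => P.[expi t]).
Proof.
move=> n0 sP; have [->|q0 /(_ isT)] := eqVneq q 0.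
  move=> _; rewrite horner0 cabs0 powR0 ?gt_eqF // mul0r.
  have -> : euler_op 0 P = 0.
    by apply/polyP => k; rewrite coef_euler_op horner0 mul0r coef0.
  rewrite (_ : (fun t => _) = (fun=> 0)); last by apply/funext => t; rewrite horner0.
  by rewrite powR_integral_cst cabs0 powR0 ?gt_eqF // mulr0.
have [s ->] := closed_field_poly_normal q; set c := lead_coef q => qn.
have {qn} sn : all (fun a => Re a <= n%:R / 2) s.
  apply/allP => a sa; apply: qn; rewrite rootE hornerZ.
  have : root (\prod_(z <- s) ('X - z%:P)) a by rewrite root_prod_XsubC.
  by move/rootP ->; rewrite mulr0.
rewrite euler_opZl hornerZ.
have -> : (fun t => (c *: euler_op (\prod_(z <- s) ('X - z%:P)) P).[expi t]) =
  (fun t => c * (euler_op (\prod_(z <- s) ('X - z%:P)) P).[expi t]).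
  by apply/funext => t; rewrite hornerZ.
rewrite powR_integralZ; last exact: ccontinuous_horner_expi.
rewrite cabsM powRM ?cabs_ge0 // -mulrA ler_wpM2l ?powR_ge0 //.
elim: s sn {q q0 c} => [_|a s IHs /= /andP[an /IHs{}IHs]].
  rewrite big_nil hornerC cabs1 powR1 mul1r.
  by rewrite -[1]/(1%:P) euler_opC scale1r.
rewrite big_cons euler_opM hornerM hornerXsubC cabsM powRM ?cabs_ge0 // -mulrA.
rewrite (le_trans (euler_powR_integral_le n0 an _)) ?size_euler_op //.
by rewrite ler_wpM2l ?powR_ge0.
Qed.

Definition affine_integral a b := powR_integral (fun t => a * expi t + b).

Lemma ccontinuous_affine a b : ccontinuous (fun t => a * expi t + b).
Proof.
apply: ccontinuousD (ccontinuous_cst _); apply: ccontinuousM (@ccontinuous_expi R).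
exact: ccontinuous_cst.
Qed.

Lemma polar z : exists x, z = (cabs z)%:C * expi x.
Proof.
have [->|z0] := eqVneq z 0; first by exists 0; rewrite cabs0 rmorph0 mul0r.
have [|x _ xE] := @expi_surj _ (z / (cabs z)%:C).
  by rewrite cabsE normrM normfV normr_id divff // normr_eq0.
by exists x; rewrite -xE mulrC divfK // cabsE normr_eq0.
Qed.

(** Rotating the variable removes the arguments of a and b. *)
Lemma affine_integral_norm a b :
  affine_integral a b = affine_integral (cabs a)%:C (cabs b)%:C.
Proof.
have [x ax] := polar a; have [y bY] := polar b.
have [|s s2 sE] := @expi_surj _ (expi x / expi y : C).
  by rewrite normrM normfV !norm_expi divr1.
rewrite /affine_integral /powR_integral.
rewrite -(Rintegral_rotate
  (h := fun t => cabs ((cabs a)%:C * expi t + (cabs b)%:C) `^ p) _ _ s2).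
- apply: eq_Rintegral => t _; congr (_ `^ _).
  rewrite -[RHS]mulr1 -(cabs_expi y) -cabsM {1}ax {1}bY; congr cabs.
  by rewrite expiD -sE; field; exact: expi_neq0.
- exact: continuous_cabs_powR (ccontinuous_affine _ _).
- by move=> t; rewrite expiD expi_2pi mulr1.
Qed.

Lemma affine_integral_abs a b a' b' : cabs a = cabs a' -> cabs b = cabs b' ->
  affine_integral a b = affine_integral a' b'.
Proof. by move=> aa bb; rewrite affine_integral_norm aa bb -affine_integral_norm. Qed.

Lemma affine_integralC a b : affine_integral a b = affine_integral b a.
Proof.
rewrite affine_integral_norm [RHS]affine_integral_norm /affine_integral.
apply: eq_Rintegral => t _; congr (_ `^ _).
move: (cabs a) (cabs b) => x y.
rewrite !cabs_sqrt /= !mul0r !subr0 !addr0; congr Num.sqrt.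
have := cos2Dsin2 t; move: (cos t) (sin t) => c r cr.
apply: subr0_eq; transitivity ((x ^+ 2 - y ^+ 2) * (c ^+ 2 + r ^+ 2 - 1)); first by ring.
by rewrite cr subrr mulr0.
Qed.

(** On the first quadrant of the circle |1 + z| >= 1. *)
Lemma affine_integral11_gt0 : 0 < affine_integral 1 1.
Proof.
have c11 := ccontinuous_affine 1 1.
have pi0 := pi_ge0 R; have pi2 : 0 <= pi / 2 :> R by rewrite divr_ge0.
have pi2pi : pi / 2 <= 2 * pi :> R by lra.
rewrite /affine_integral /powR_integral.
rewrite (Rintegral_itv_cat (continuous_cabs_powR c11) pi2 pi2pi).
apply: ltr_wpDr; first by apply: Rintegral_ge0 => t _; exact: powR_ge0.
apply: (@lt_le_trans _ _ (\int[mu]_(t in `[0, pi / 2]) 1)).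
  have e : mu (`[0, pi / 2]%classic : set R) = (pi / 2)%:E.
    by rewrite lebesgue_measure_itv /= lte_fin divr_gt0 ?pi_gt0 // oppr0 adde0.
  rewrite Rintegral_cst // mul1r (_ : fine _ = pi / 2); last first.
    by have := congr1 fine e.
  by rewrite divr_gt0 ?pi_gt0.
apply: le_Rintegral => //.
- by apply: integrable_continuous_itv => x; exact: cvg_cst.
- by apply: integrable_continuous_itv; exact: continuous_cabs_powR.
move=> t /=; rewrite in_itv /= => /andP[t0 tpi].
have -> : 1 = 1 `^ p :> R by rewrite powR1.
apply: ge0_ler_powR; rewrite ?nnegrE ?cabs_ge0 ?(ltW p0) //.
have ct : 0 <= cos t by rewrite cos_ge0_pihalf // tpi andbT (le_trans _ t0) // oppr_le0.
rewrite -ler_sqr ?nnegrE ?cabs_ge0 // cabs_sqrt sqr_sqrtr ?addr_ge0 ?sqr_ge0 //.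
rewrite /= !mul1r !mul0r !subr0 !addr0; have := sqr_ge0 (sin t); nra.
Qed.

(** For q the symbol and r its conjugate, integrate |((q + w r)(zD)P)(z)|^p over
    both z and w = e^(iy), in the two orders. *)
Lemma self_inversive_powR_integral n s P : (0 < n)%N -> size P = n.+1 ->
  self_inversive P -> all (fun a => Re a <= n%:R / 2) s ->
  powR_integral (fun t => (euler_op (symbol s) P).[expi t]) * affine_integral 1 1 <=
  affine_integral (symbol s).[n%:R] (symbol s).[0] *
    powR_integral (fun t => P.[expi t]).
Proof.
move=> n0 sP siP sn.
pose A t := (euler_op (symbol s) P).[expi t].
pose B t := (euler_op (conj_symbol n s) P).[expi t].
have cA : ccontinuous A := ccontinuous_horner_expi _.
have cB : ccontinuous B := ccontinuous_horner_expi _.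
have AB t : cabs (B t) = cabs (A t).
  by apply: eq_cabs; apply: euler_conj_symbol => //; exact: norm_expi.
pose h (x : R * R) := cabs (A x.1 + B x.1 * expi x.2) `^ p.
have mh : measurable_fun [set: R * R] (EFin \o h).
  apply/measurable_EFinP; apply: (measurableT_comp (f := fun x => x `^ p)) => //.
  by apply: measurable_cabs; exact: cmeasurable_pencil.
have h0 x : (0 <= (EFin \o h) x)%E by rewrite lee_fin powR_ge0.
have inner t : \int[mu]_(y in circle) h (t, y) = cabs (A t) `^ p * affine_integral 1 1.
  have -> : affine_integral 1 1 = powR_integral (fun y => 1 * expi y + 1) by [].
  rewrite -powR_integralZ; last exact: ccontinuous_affine.
  transitivity (affine_integral (B t) (A t)).
    by apply: eq_Rintegral => y _; rewrite /h /= addrC.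
  have BA : cabs (B t) = cabs (A t * 1) by rewrite mulr1 AB.
  have AA : cabs (A t) = cabs (A t * 1) by rewrite mulr1.
  apply: etrans (affine_integral_abs BA AA) _.
  by apply: eq_Rintegral => y _; congr (cabs _ `^ _); ring.
have ch t : mu.-integrable circle (EFin \o (fun y => h (t, y))).
  have := integrable_cabs_powR (ccontinuous_affine (B t) (A t)).
  by congr integrable; apply/funext => y; rewrite /h /= addrC.
have ch2 y : mu.-integrable circle (EFin \o (fun t => h (t, y))).
  apply: (@integrable_cabs_powR (fun t => A t + B t * expi y)).
  by apply: ccontinuousD => //; apply: ccontinuousM (ccontinuous_cst _).
have EI (f : R -> R) : mu.-integrable circle (EFin \o f) ->
    (\int[mu]_(t in circle) (f t)%:E = (\int[mu]_(t in circle) f t)%:E)%E.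
  by move=> fi; rewrite /Rintegral fineK //; exact: integrable_fin_num fi.
have EZ (f : R -> C) k : ccontinuous f ->
    (\int[mu]_(t in circle) (cabs (f t) `^ p * k)%:E = (powR_integral f * k)%:E)%E.
  move=> cf; rewrite /powR_integral -RintegralZr //; last exact: integrable_cabs_powR.
  rewrite EI //; apply: (@integrable_continuous_itv _ (fun t => cabs (f t) `^ p * k)).
  by move=> x; apply: cvgM; [exact: continuous_cabs_powR|exact: cvg_cst].
have LHSE : (\int[mu]_(t in circle) \int[mu]_(y in circle) (h (t, y))%:E =
    (powR_integral A * affine_integral 1 1)%:E)%E.
  by rewrite -EZ //; apply: eq_integral => t _; rewrite EI // inner.
pose a := (symbol s).[n%:R]; pose b := (conj_symbol n s).[n%:R].
have ab : cabs b = cabs (symbol s).[0].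
  by rewrite /b conj_symbol_nat // subnn cabsJ.
have -> : affine_integral (symbol s).[n%:R] (symbol s).[0] = affine_integral b a.
  by rewrite affine_integralC; exact: affine_integral_abs.
rewrite -lee_fin -LHSE (tonelli_lebesgue _ _ mh h0) //.
rewrite -(EZ _ _ (ccontinuous_affine b a)).
have cm : continuous (fun y =>
    cabs (b * expi y + a) `^ p * powR_integral (fun t => P.[expi t])).
  move=> x; apply: cvgM; last exact: cvg_cst.
  exact: continuous_cabs_powR (ccontinuous_affine _ _) x.
apply: ge0_le_integral => //.
- by move=> y _; apply: integral_ge0 => t _; exact: h0.
- by apply: measurable_funTS; exact: (measurable_fun_tonelli _ mh h0).
- by apply/measurable_EFinP; apply: measurable_funTS; exact: continuous_measurable_fun.
move=> y _; rewrite EI // lee_fin.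
pose q := symbol s + expi y *: conj_symbol n s.
have qn : q.[n%:R] = b * expi y + a by rewrite hornerD hornerZ /a /b; ring.
rewrite -qn; have := @symbol_powR_integral_le n q P n0 _ _.
rewrite sP leqnn => /(_ isT) le_q; apply: le_trans (le_q _); last first.
  by move=> q0 z; apply: pencil_root sn _ q0; exact: norm_expi.
rewrite le_eqVlt; apply/orP; left; apply/eqP; apply: eq_Rintegral => t _.
rewrite /h /= /A /B /q euler_opDl euler_opZl hornerD hornerZ.
by rewrite [expi y * _]mulrC.
Qed.

End PowerNorms.

(** * Circle norms *)

Section CircleNorm.
Variable R : realType.
Local Notation C := R[i].
Local Notation mu := (@lebesgue_measure R).
Local Notation circle := (`[0, 2 * pi]%classic : set R).
Implicit Types (a b c d k z w : C) (s : seq C) (p : R) (P F G f g : {poly C}) (n : nat).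
Local Notation Re := (@complex.Re R).

Lemma circle_norm_gt0E p f : 0 < p -> circle_norm p f =
  ((2 * pi)^-1 * powR_integral p (fun t => f.[expi t])) `^ p^-1.
Proof. by move=> p0; rewrite /circle_norm gt_eqF. Qed.

Lemma circle_norm_ge0 p f : 0 <= circle_norm p f.
Proof.
by rewrite /circle_norm; case: ifP => _; [case: ifP|]; rewrite ?expR_ge0 ?powR_ge0.
Qed.

(** The conventions for ln 0 and lne 0 differ only on the zero set of f, which is
    null because log|f| is integrable. *)
Lemma circle_norm0_log_mean f v : f != 0 -> log_mean (fun t => f.[expi t]) v ->
  circle_norm 0 f = expR v.
Proof.
move=> f0 [fi fv]; rewrite /circle_norm eqxx (negPf f0); congr expR.
rewrite /circle_mean /Rintegral; apply: (mulfI (lt0r_neq0 (twopi_gt0 R))).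
rewrite mulrA divff ?mul1r ?lt0r_neq0 ?twopi_gt0 //.
rewrite -[RHS]/(fine (2 * pi * v)%:E) -fv; congr fine.
have cf := continuous_cabs (ccontinuous_horner_expi f).
apply: ae_eq_integral => //.
- apply/measurable_EFinP; apply: measurable_funTS.
  by apply: measurableT_comp => //; exact: continuous_measurable_fun cf.
- by case/integrableP: fi.
have fin_ln (x : R) : elog x \is a fin_num -> (ln x)%:E = elog x.
  by rewrite /elog /=; case: ifP.
have := integrable_ae _ fi; move=> /(_ ltac:(by [])).
apply: filterS => t H Dt; exact: fin_ln (H Dt).
Qed.

Lemma circle_norm0_roots_in_disk n G : roots_in_disk n G ->
  circle_norm 0 G = cabs G`_n.
Proof.
move=> Gn; have [sG _] := Gn.
have G0 : G != 0 by rewrite -size_poly_gt0 sG.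
rewrite (circle_norm0_log_mean G0 (log_mean_roots_in_disk Gn)) lnK // posrE.
by rewrite cabs_gt0 -[G`_n]/(G`_(n.+1.-1)) -sG -lead_coefE lead_coef_eq0.
Qed.

Lemma le_circle_norm0 n f G : roots_in_disk n G ->
  (size f <= n.+1)%N -> (forall t, cabs f.[expi t] <= cabs G.[expi t]) ->
  circle_norm 0 f <= circle_norm 0 G.
Proof.
move=> Gn sf fG; have [->|f0] := eqVneq f 0.
  by rewrite {1}/circle_norm !eqxx circle_norm_ge0.
have [H [Hn _ _ fH]] := flip_roots f0 sf.
have LH : log_mean (fun t => f.[expi t]) (ln (cabs H`_n)).
  apply: eq_log_mean (log_mean_roots_in_disk Hn) => t.
  by apply: eq_cabs; rewrite fH // norm_expi.
have G0 : G != 0 by have [sG _] := Gn; rewrite -size_poly_gt0 sG.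
have LG := log_mean_roots_in_disk Gn.
rewrite (circle_norm0_log_mean f0 LH) (circle_norm0_log_mean G0 LG) ler_expR.
rewrite -(ler_pM2l (twopi_gt0 R)) -lee_fin -(proj2 LH) -(proj2 LG).
by apply: le_integral => // [||t _]; [case: LH|case: LG|exact: le_elog].
Qed.

Lemma circle_norm0_euler n d P : (0 < n)%N -> Re d <= n%:R / 2 -> (size P <= n.+1)%N ->
  circle_norm 0 (euler_op ('X - d%:P) P) <= cabs (n%:R - d) * circle_norm 0 P.
Proof.
move=> n0 dn sP; have [->|P0] := eqVneq P 0.
  by rewrite euler_op0 /circle_norm !eqxx mulr0.
have [G [Gn PG TGn TPG]] := euler_op_majorant n0 dn P0 sP.
rewrite (le_trans (le_circle_norm0 TGn _ TPG)) ?size_euler_op //.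
have LP : log_mean (fun t => P.[expi t]) (ln (cabs G`_n)).
  exact: eq_log_mean (fun t => esym (PG t)) (log_mean_roots_in_disk Gn).
have G0 : 0 < cabs G`_n.
  have [sG _] := Gn; rewrite cabs_gt0 -[G`_n]/(G`_(n.+1.-1)) -sG -lead_coefE.
  by rewrite lead_coef_eq0 -size_poly_gt0 sG.
rewrite (circle_norm0_log_mean P0 LP) lnK ?posrE //.
by rewrite (circle_norm0_roots_in_disk TGn) coef_euler_op hornerXsubC cabsM.
Qed.

(** This is [conj_symbol_le] at z = n, where the conjugate symbol takes the value
    conj q(0). *)
Lemma symbol0_le n s : (0 < n)%N -> all (fun a => Re a <= n%:R / 2) s ->
  (symbol s).[n%:R] != 0 /\ cabs (symbol s).[0] <= cabs (symbol s).[n%:R].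
Proof.
move=> n0 sn; have [|q0 le_q _] := @conj_symbol_le _ n s n%:R sn.
  by rewrite -(rmorph_nat (real_complex R)) lt_half_nat.
by split=> //; rewrite -le_cabs conj_symbol_nat // subnn cabsJ in le_q.
Qed.

Lemma roots_in_disk_binomial n a b : (0 < n)%N -> a != 0 -> cabs b <= cabs a ->
  roots_in_disk n (a *: 'X^n + b%:P).
Proof.
move=> n0 a0 ba; split.
  rewrite size_polyDl size_scale ?size_polyXn //.
  by rewrite (leq_ltn_trans (size_polyC_leq1 _)) // ltnS.
move=> z z1; rewrite hornerD hornerZ hornerXn hornerC addr_eq0.
apply/eqP => e; move: ba; rewrite le_cabs -normrN -e normrM normrX.
apply/negP; rewrite -real_ltNge ?realE ?normr_ge0 ?mulr_ge0 ?exprn_ge0 //.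
by rewrite ltr_pMr ?normr_gt0 // exprn_egt1 // -lt0n.
Qed.

Lemma circle_norm0_binomial n a b : (0 < n)%N -> a != 0 -> cabs b <= cabs a ->
  circle_norm 0 (a *: 'X^n + b%:P) = cabs a.
Proof.
move=> n0 a0 ba; rewrite (circle_norm0_roots_in_disk (roots_in_disk_binomial n0 a0 ba)).
by rewrite coefD coefZ coefXn eqxx mulr1 coefC gtn_eqF ?addr0.
Qed.

(** For p > 0 the substitution t -> nt turns z^n into z; for p = 0, as |b| <= |a|,
    the norm is the modulus of the leading coefficient. *)
Lemma circle_norm_binomial p n a b k a' b' : 0 <= p -> (0 < n)%N ->
  a != 0 -> cabs b <= cabs a -> k != 0 ->
  cabs a' = cabs k * cabs a -> cabs b' = cabs k * cabs b ->
  circle_norm p (a' *: 'X^n + b'%:P) = cabs k * circle_norm p (a *: 'X + b%:P).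
Proof.
move=> p0 n0 a0 ba k0 a'E b'E.
have a'0 : a' != 0 by rewrite -cabs_eq0 a'E mulf_neq0 ?cabs_eq0.
have b'a' : cabs b' <= cabs a' by rewrite a'E b'E ler_wpM2l ?cabs_ge0.
move: p0; rewrite le0r => /predU1P[->|p0].
  by rewrite -[X in _ *: X + b%:P]expr1 !circle_norm0_binomial.
rewrite !circle_norm_gt0E //.
have -> : powR_integral p (fun t => (a' *: 'X^n + b'%:P).[expi t]) =
    affine_integral p a' b'.
  have cJ := continuous_cabs_powR p0 (ccontinuous_affine a' b').
  apply: etrans (Rintegral_dilate cJ _ n0); last first.
    by move=> t; rewrite expiD expi_2pi mulr1.
  apply: eq_Rintegral => t _.
  by rewrite hornerD hornerZ hornerXn hornerC mulr_natl expiMn.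
have -> : (fun t => (a *: 'X + b%:P).[expi t]) = (fun t => a * expi t + b).
  by apply/funext => t; rewrite !hornerE.
have -> : affine_integral p a' b' = affine_integral p (k * a) (k * b).
  by apply: affine_integral_abs; rewrite // cabsM.
have -> : affine_integral p (k * a) (k * b) =
    cabs k `^ p * powR_integral p (fun t => a * expi t + b).
  apply: etrans (powR_integralZ p0 k (ccontinuous_affine a b)).
  by apply: eq_Rintegral => t _; congr (cabs _ `^ _); ring.
rewrite mulrCA powRM ?powR_ge0 ?mulr_ge0 ?powR_integral_ge0 ?invr_ge0 ?(ltW (twopi_gt0 R)) //.
by rewrite -powRrM divff ?gt_eqF // powRr1 ?cabs_ge0.
Qed.

Lemma circle_norm_1X_gt0 p : 0 <= p -> 0 < circle_norm p (1 + 'X : {poly C}).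
Proof.
have -> : 1 + 'X = 1 *: 'X + 1%:P :> {poly C} by rewrite scale1r polyC1 addrC.
rewrite le0r => /predU1P[->|p0].
  by rewrite -['X]expr1 circle_norm0_binomial ?oner_eq0 // cabs1.
rewrite circle_norm_gt0E // powR_gt0 // mulr_gt0 ?invr_gt0 ?twopi_gt0 //.
have -> : (fun t => (1 *: 'X + 1%:P : {poly C}).[expi t]) = (fun t => 1 * expi t + 1).
  by apply/funext => t; rewrite !hornerE.
exact: affine_integral11_gt0.
Qed.

Lemma normalized_powR_le p (m I J J1 M : R) : 0 < p -> 0 < m ->
  0 <= I -> 0 <= J -> 0 < J1 -> 0 <= M -> I <= J * M / J1 ->
  (m * I) `^ p^-1 <= (m * J) `^ p^-1 * ((m * M) `^ p^-1 / (m * J1) `^ p^-1).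
Proof.
move=> p0 m0 I0 J0 J1_0 M0 le_I; have m0' := ltW m0; have J1_0' := ltW J1_0.
rewrite mulrA ler_pdivlMr ?powR_gt0 ?mulr_gt0 // -!powRM ?mulr_ge0 //.
apply: ge0_ler_powR; rewrite ?invr_ge0 ?(ltW p0) ?nnegrE ?mulr_ge0 //.
by rewrite mulrACA [leRHS]mulrACA ler_pM2l ?mulr_gt0 // -ler_pdivlMr.
Qed.

Lemma self_inversive_symbol_le p n s P : 0 <= p -> (0 < n)%N ->
  all (fun a => Re a <= n%:R / 2) s -> size P = n.+1 -> self_inversive P ->
  circle_norm p (euler_op (symbol s) P) <=
  circle_norm p ((symbol s).[n%:R] *: 'X + (symbol s).[0]%:P) *
    (circle_norm p P / circle_norm p (1 + 'X)).
Proof.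
move=> p0 n0 sn sP siP; have [q0 le_q] := symbol0_le n0 sn.
have E1 : 1 + 'X = 1 *: 'X + 1%:P :> {poly C} by rewrite scale1r polyC1 addrC.
move: p0; rewrite le0r => /predU1P[->|p0].
  rewrite E1 -['X]expr1 !circle_norm0_binomial ?oner_eq0 // cabs1 divr1.
  have {sP siP} : (size P <= n.+1)%N by rewrite sP.
  elim: s sn {q0 le_q} => [_|a s IHs /= /andP[an /IHs{}IHs]] sP.
    rewrite /symbol big_nil hornerC cabs1 mul1r.
    by rewrite -[1]/(1%:P) euler_opC scale1r.
  rewrite /symbol big_cons -/(symbol s) euler_opM hornerM hornerXsubC cabsM -mulrA.
  rewrite (le_trans (circle_norm0_euler n0 an _)) ?size_euler_op //.
  by rewrite ler_wpM2l ?cabs_ge0 ?IHs.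
have J0 := affine_integral11_gt0 p0.
have := self_inversive_powR_integral p0 n0 sP siP sn.
rewrite -ler_pdivlMr // E1 !circle_norm_gt0E //.
have affE a b : (fun t => (a *: 'X + b%:P : {poly C}).[expi t]) = (fun t => a * expi t + b).
  by apply/funext => t; rewrite !hornerE.
rewrite !affE -/(affine_integral p _ _) -/(affine_integral p 1 1).
by apply: normalized_powR_le; rewrite ?powR_integral_ge0 ?invr_gt0 ?twopi_gt0.
Qed.

End CircleNorm.

(** * Self-inversive binomials and the theorem *)

Section Binomial.
Variable R : realType.
Local Notation C := R[i].
Implicit Types (a z : C) (s : seq C) (p : R) (n : nat).
Local Notation Re := (@complex.Re R).

Definition self_inversive_binomial n a : {poly C} := a *: 'X^n + (a^*%C)%:P.
Local Notation binom := self_inversive_binomial.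

Lemma size_binomial n a : (0 < n)%N -> a != 0 -> size (binom n a) = n.+1.
Proof.
move=> n0 a0.
by case: (roots_in_disk_binomial n0 a0 (_ : cabs a^*%C <= _)); rewrite ?cabsJ.
Qed.

Lemma binomial_self_inversive n a : (0 < n)%N -> a != 0 -> self_inversive (binom n a).
Proof.
move=> n0 a0; exists 1; first exact: normr1.
move=> z z0; rewrite size_binomial // mul1r /=.
rewrite /binom !hornerD !hornerZ !hornerXn !hornerC rmorphD rmorphM rmorphXn fmorphV /=.
rewrite !conjCK (_ : a^*%C = Num.conj a) // exprVn.
by rewrite mulrDr mulrCA divff ?expf_neq0 // mulr1 addrC mulrC.
Qed.

Lemma circle_norm_self_inversive_binomial p n a : 0 <= p -> (0 < n)%N -> a != 0 ->
  circle_norm p (binom n a) = cabs a * circle_norm p (1 + 'X : {poly C}).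
Proof.
move=> p0 n0 a0; have -> : 1 + 'X = 1 *: 'X + 1%:P :> {poly C}.
  by rewrite scale1r polyC1 addrC.
by apply: circle_norm_binomial; rewrite ?oner_eq0 ?cabs1 ?cabsJ ?mulr1.
Qed.

Lemma symbol_binomial p n s a : 0 <= p -> (0 < n)%N -> a != 0 ->
  all (fun b => Re b <= n%:R / 2) s ->
  circle_norm p (euler_op (symbol s) (binom n a)) =
  circle_norm p ((symbol s).[n%:R] *: 'X + (symbol s).[0]%:P) *
    (circle_norm p (binom n a) / circle_norm p (1 + 'X)).
Proof.
move=> p0 n0 a0 sn; have [q0 le_q] := symbol0_le n0 sn.
rewrite circle_norm_self_inversive_binomial // mulfK ?gt_eqF ?circle_norm_1X_gt0 // mulrC.
rewrite euler_opDr euler_opZr euler_opXn euler_op_const scalerA.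
by apply: circle_norm_binomial; rewrite // !cabsM // cabsJ mulrC.
Qed.

End Binomial.

Theorem theorem3 (R : realType) (n : nat) (alpha gamma : R[i]) (p : R)
    (n_gt0 : (0 < n)%N)
    (alpha_le : complex.Re alpha <= n%:R / 2)
    (gamma_le : complex.Re gamma <= n%:R / 2)
    (p_ge0 : 0 <= p) :
  let T1 (P : {poly R[i]}) : {poly R[i]} := 'X * P^`() - alpha *: P in
  let T2 (P : {poly R[i]}) : {poly R[i]} :=
    'X^2 * P^`(2) + (1 - alpha - gamma) *: ('X * P^`())
      + (alpha * gamma) *: P in
  let K1 : R := circle_norm p ((n%:R - alpha) *: 'X + alpha%:P) in
  let K2 : R :=
    circle_norm p ((n%:R * (n%:R - alpha - gamma) + alpha * gamma) *: 'X
                   + (alpha * gamma)%:P) in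
  let N (P : {poly R[i]}) : R := circle_norm p P / circle_norm p (1 + 'X) in
  [/\ (* the inequalities *)
      forall P : {poly R[i]}, size P = n.+1 -> self_inversive P ->
        circle_norm p (T1 P) <= K1 * N P /\ circle_norm p (T2 P) <= K2 * N P,
      (* the constants K1 and K2 are best possible *)
      forall C : R,
        (forall P : {poly R[i]}, size P = n.+1 -> self_inversive P ->
           circle_norm p (T1 P) <= C * N P) -> K1 <= C,
      forall C : R,
        (forall P : {poly R[i]}, size P = n.+1 -> self_inversive P ->
           circle_norm p (T2 P) <= C * N P) -> K2 <= C
    & (* the case of equality *)
      forall a : R[i], a != 0 ->
        let P : {poly R[i]} := a *: 'X^n + (a^*)%:P in
        circle_norm p (T1 P) = K1 * N P /\ circle_norm p (T2 P) = K2 * N P].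
Proof.
move=> T1 T2 K1 K2 N.
pose s1 := [:: alpha]; pose s2 := [:: alpha; gamma].
have s1n : all (fun b => complex.Re b <= n%:R / 2) s1 by rewrite /= alpha_le.
have s2n : all (fun b => complex.Re b <= n%:R / 2) s2 by rewrite /= alpha_le gamma_le.
have T1E P : T1 P = euler_op (symbol s1) P.
  by rewrite /symbol big_seq1 euler_opXsubC.
have T2E P : T2 P = euler_op (symbol s2) P.
  by rewrite /symbol big_cons big_seq1 euler_op_quad.
have K1E : K1 = circle_norm p ((symbol s1).[n%:R] *: 'X + (symbol s1).[0]%:P).
  have [q0 le_q] := symbol0_le n_gt0 s1n.
  rewrite -[RHS]mul1r -(cabs1 R).
  rewrite -(@circle_norm_binomial _ p 1 _ _ _ (n%:R - alpha) alpha) //.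
  - by rewrite cabs1 mul1r horner_symbol big_seq1.
  - by rewrite cabs1 mul1r horner_symbol big_seq1 sub0r cabsN.
have K2E : K2 = circle_norm p ((symbol s2).[n%:R] *: 'X + (symbol s2).[0]%:P).
  have -> : (symbol s2).[n%:R] = n%:R * (n%:R - alpha - gamma) + alpha * gamma.
    by rewrite horner_symbol big_cons big_seq1; ring.
  have -> : (symbol s2).[0] = alpha * gamma.
    by rewrite horner_symbol big_cons big_seq1 !sub0r mulrNN.
  reflexivity.
have eqs a : a != 0 -> let P := self_inversive_binomial n a in
    circle_norm p (T1 P) = K1 * N P /\ circle_norm p (T2 P) = K2 * N P.
  by move=> a0 P; rewrite T1E T2E K1E K2E; split; apply: symbol_binomial.
have one0 : 1 != 0 :> R[i] by exact: oner_neq0.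
have N1 : N (self_inversive_binomial n 1) = 1.
  rewrite /N (circle_norm_self_inversive_binomial p_ge0 n_gt0 one0) cabs1 mul1r.
  exact: divff (lt0r_neq0 (circle_norm_1X_gt0 p_ge0)).
have NE P : N P = circle_norm p P / circle_norm p (1 + 'X) by [].
clearbody N K1 K2 T1 T2.
have [e1 e2] := eqs 1 one0; rewrite N1 !mulr1 in e1 e2.
have sz := size_binomial n_gt0 one0; have si := binomial_self_inversive n_gt0 one0.
split.
- move=> P sP siP; rewrite T1E T2E K1E K2E NE.
  by split; apply: self_inversive_symbol_le.
- by move=> C /(_ _ sz si); rewrite e1 N1 mulr1.
- by move=> C /(_ _ sz si); rewrite e2 N1 mulr1.
- exact: eqs.
Qed.
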